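(* Let $G$ be a finitely generated Coxeter group. Then the quotient map $\mathrm{Aut}(G) \to \mathrm{Out}(G)$ splits virtually. Moreover $\mathrm{Out}(G)$ is virtually residually $p$ for all but finitely many primes $p$. In particular $\mathrm{Out}(G)$ is residually finite and virtually torsion-free.
   Context: A Coxeter group is a group $G$ defined by a presentation $\langle S \mid (st)^{m_{st}} = 1 \text{ for each } s,t\in S \text{ with } m_{st} \neq \infty \rangle$, where $m_{ss} = 1$ for each $s \in S$ and $m_{st} = m_{ts} \in \{2,3,4,\ldots\} \cup \{\infty\}$ for each $s \neq t$ in $S$. For a group $G$, $\mathrm{Inn}(G)$ is the group of inner automorphisms and $\mathrm{Out}(G) = \mathrm{Aut}(G)/\mathrm{Inn}(G)$. A group epimorphism $f : A \to B$ splits virtually if there exist a finite index subgroup $B' < B$ and a homomorphism $g : B' \to A$ with $f \circ g = \mathrm{Id}_{B'}$. A group is residually finite if the intersection of its finite index subgroups is trivial. For a prime $p$, a group $\Gamma$ is residually $p$ if for every $1 \neq \gamma \in \Gamma$ there is a homomorphism $\varphi$ from $\Gamma$ onto a finite $p$-group with $\varphi(\gamma) \neq 1$. A group virtually has a property if some finite index subgroup has it. *)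

(* Defs.v *)
From HB Require Import structures.
From mathcomp Require Import fingroup pgroup all_boot generic_quotient.
From mathcomp Require Import boolp.

Set Implicit Arguments.
Unset Strict Implicit.
Unset Printing Implicit Defensive.

Local Open Scope group_scope.
Local Open Scope quotient_scope.

(* Subgroups of G are terms of the library type groupClosed G: boolean
   predicates closed under the group operations. Excluded middle turns any
   Prop-valued predicate into a boolean one, so this is no restriction. *)
Definition subgroup_type (G : groupType) (H : groupClosed G) : Type :=
  {x : G | x \in H}.

Lemma subgroup_closed (G : groupType) (H : groupClosed G) :
  group_closed [pred x : G | x \in H].
Proof. by split=> [|x y xH yH]; [exact: gpred1 | exact: gpredF]. Qed.

HB.instance Definition _ (G : groupType) (H : groupClosed G) :=
  SubChoice.on (subgroup_type H).
HB.instance Definition _ (G : groupType) (H : groupClosed G) :=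
  SubChoice_isSubGroup.Build G [pred x : G | x \in H] (subgroup_type H)
    (subgroup_closed H).

Section GroupProperties.
Implicit Types G A B : groupType.

Definition finitely_generated G : Prop :=
  exists gens : seq G, forall H : groupClosed G,
    {subset gens <= H} -> forall x, x \in H.

(* G is covered by finitely many left cosets y H. *)
Definition finite_index G (H : groupClosed G) : Prop :=
  exists ys : seq G, forall x, exists2 y, y \in ys & y^-1 * x \in H.

Definition virtually (P : groupType -> Prop) G : Prop :=
  exists2 H : groupClosed G, finite_index H & P (subgroup_type H).

Definition residually_finite G : Prop :=
  forall x : G, (forall H : groupClosed G, finite_index H -> x \in H) -> x = 1.

Definition residually_p (p : nat) G : Prop :=
  forall x : G, x <> 1 ->
  exists (Q : finGroupType) (phi : {multiplicative G -> Q}),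
    [/\ p.-group [set: Q], forall q, exists y, phi y = q & phi x <> 1].

Definition torsion_free G : Prop :=
  forall (x : G) (n : nat), (0 < n)%N -> x ^+ n = 1 -> x = 1.

Definition splits_virtually A B (f : {multiplicative A -> B}) : Prop :=
  exists2 B' : groupClosed B, finite_index B' &
  exists g : {multiplicative subgroup_type B' -> A},
    forall b, f (g b) = val b.

End GroupProperties.

Section Presentations.
Variable S : Type.

(* The letter (s, false) stands for s and (s, true) for its formal inverse. *)
Definition word := seq (S * bool).

(* The congruence on words whose quotient is the group < S | R >, where
   R is the set of relators. *)
Inductive word_eq (R : word -> Prop) : word -> word -> Prop :=
| word_eq_refl w : word_eq R w w
| word_eq_sym v w : word_eq R v w -> word_eq R w v
| word_eq_trans u v w : word_eq R u v -> word_eq R v w -> word_eq R u w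
| word_eq_cat v v' w w' :
    word_eq R v v' -> word_eq R w w' -> word_eq R (v ++ w) (v' ++ w')
| word_eq_cancel s b : word_eq R [:: (s, b); (s, ~~ b)] [::]
| word_eq_relator r : R r -> word_eq R r [::].

Definition eval_word (G : groupType) (iota : S -> G) (w : word) : G :=
  \prod_(l <- w) (if l.2 then (iota l.1)^-1 else iota l.1).

(* iota : S -> G induces an isomorphism from < S | R > onto G. *)
Definition is_presented_by (G : groupType) (iota : S -> G)
    (R : word -> Prop) : Prop :=
  (forall x : G, exists w, eval_word iota w = x) /\
  (forall w, eval_word iota w = 1 <-> word_eq R w [::]).

(* None encodes the value infinity. *)
Definition is_coxeter_matrix (m : S -> S -> option nat) : Prop :=
  [/\ forall s, m s s = Some 1%N,
      forall s t, m s t = m t s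
    & forall s t k, s <> t -> m s t = Some k -> (2 <= k)%N].

Definition coxeter_relator (m : S -> S -> option nat) (r : word) : Prop :=
  exists s t k,
    m s t = Some k /\ r = flatten (nseq k [:: (s, false); (t, false)]).

End Presentations.

Definition is_coxeter_group (G : groupType) : Prop :=
  exists (S : Type) (m : S -> S -> option nat) (iota : S -> G),
    is_coxeter_matrix m /\ is_presented_by iota (coxeter_relator m).

Record Aut (G : groupType) : Type := MkAut {
  aut_fun :> G -> G;
  aut_morph : {morph aut_fun : x y / x * y};
  aut_bij : bijective aut_fun
}.

HB.instance Definition _ (G : groupType) := gen_eqMixin (Aut G).
HB.instance Definition _ (G : groupType) := gen_choiceMixin (Aut G).

Section AutGroup.
Variable G : groupType.
Implicit Types a b c : Aut G.

Lemma autP a b : a =1 b -> a = b.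
Proof.
case: a b => [f fM fB] [g gM gB] /= /funext fg; case: _ / fg in gM gB *.
by congr MkAut; exact: Prop_irrelevance.
Qed.

Definition aut_one : Aut G :=
  @MkAut G id (fun _ _ => erefl) (Bijective (fun _ => erefl) (fun _ => erefl)).

Lemma aut_mul_morph a b : {morph a \o b : x y / x * y}.
Proof. by move=> x y /=; rewrite !aut_morph. Qed.

(* Composition of functions: (a * b) x = a (b x). *)
Definition aut_mul a b : Aut G :=
  MkAut (aut_mul_morph a b) (bij_comp (aut_bij a) (aut_bij b)).

Lemma aut_inv_subproof a :
  exists b : Aut G, cancel a b /\ cancel b a.
Proof.
have [g aK gK] := aut_bij a.
have gM : {morph g : x y / x * y}.
  by move=> x y; apply: (can_inj aK); rewrite aut_morph !gK.
by exists (MkAut gM (Bijective gK aK)).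
Qed.

Definition aut_inv a : Aut G := sval (cid (aut_inv_subproof a)).

Lemma autK a : cancel a (aut_inv a).
Proof. by rewrite /aut_inv; case: cid => b []. Qed.

Lemma autVK a : cancel (aut_inv a) a.
Proof. by rewrite /aut_inv; case: cid => b []. Qed.

Lemma aut_mulA : associative aut_mul.
Proof. by move=> a b c; exact: autP. Qed.

Lemma aut_mul1 : left_id aut_one aut_mul.
Proof. by move=> a; exact: autP. Qed.

Lemma aut_mulr1 : right_id aut_one aut_mul.
Proof. by move=> a; exact: autP. Qed.

Lemma aut_mulV : left_inverse aut_one aut_inv aut_mul.
Proof. by move=> a; apply: autP => x /=; rewrite autK. Qed.

Lemma aut_mulrV : right_inverse aut_one aut_inv aut_mul.
Proof. by move=> a; apply: autP => x /=; rewrite autVK. Qed.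

HB.instance Definition _ :=
  isGroup.Build (Aut G) aut_mulA aut_mul1 aut_mulr1 aut_mulV aut_mulrV.

End AutGroup.

Section OutGroup.
Variable G : groupType.
Implicit Types a b c : Aut G.

Lemma autM a b x : (a * b) x = a (b x). Proof. by []. Qed.
Lemma aut1 x : (1 : Aut G) x = x. Proof. by []. Qed.

Definition is_inner a : Prop := exists g : G, forall x, a x = g * x * g^-1.

Definition Inn : {pred Aut G} := fun a => `[< is_inner a >].

Lemma InnP a : reflect (is_inner a) (a \in Inn).
Proof. exact: asboolP. Qed.

Lemma Inn_mul_closed : mulg_closed Inn.
Proof.
move=> a b /InnP[g ag] /InnP[h bh]; apply/InnP; exists (g * h) => x.
by rewrite autM ag bh invgM !mulgA.
Qed.

Lemma Inn1 : 1 \in Inn.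
Proof. by apply/InnP; exists 1 => x; rewrite invg1 mulg1 mul1g. Qed.

Lemma Inn_inv_closed : invg_closed Inn.
Proof.
move=> a /InnP[g ag]; apply/InnP; exists g^-1 => x.
apply: (bij_inj (aut_bij a)); rewrite -autM mulgV aut1 ag invgK.
by rewrite !mulgA mulgV mul1g mulgK.
Qed.

HB.instance Definition _ := isMulClosed.Build (Aut G) Inn Inn_mul_closed.
HB.instance Definition _ := isMul1Closed.Build (Aut G) Inn Inn1.
HB.instance Definition _ := isInvClosed.Build (Aut G) Inn Inn_inv_closed.

Lemma Inn_normal a b : a \in Inn -> a ^ b \in Inn.
Proof.
move=> /InnP[g ag]; apply/InnP; exists (b^-1 g) => x.
apply: (bij_inj (aut_bij b)); rewrite conjgE -autM mulVKg autM ag.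
rewrite !aut_morph -!autM mulgV aut1; congr (_ * _).
apply: (mulgI g); rewrite mulgV.
rewrite -[X in X * _](aut1 g) -(mulgV b) autM -aut_morph mulgV.
by apply: (mulgI (b 1)); rewrite -aut_morph !mulg1.
Qed.

(* a and b are identified when they lie in the same coset of Inn. *)
Definition inn_equiv a b : bool := a^-1 * b \in Inn.

Lemma inn_equiv_refl : reflexive inn_equiv.
Proof. by move=> a; rewrite /inn_equiv mulVg Inn1. Qed.

Lemma inn_equiv_sym : symmetric inn_equiv.
Proof.
move=> a b; rewrite /inn_equiv; apply/idP/idP.
  by move=> /Inn_inv_closed; rewrite invgM invgK.
by move=> /Inn_inv_closed; rewrite invgM invgK.
Qed.

Lemma inn_equiv_trans : transitive inn_equiv.
Proof.
by move=> b a c ab bc; rewrite /inn_equiv -(mulgK b a^-1) -mulgA gpredM.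
Qed.

Canonical inn_equivR :=
  EquivRel inn_equiv inn_equiv_refl inn_equiv_sym inn_equiv_trans.

Definition Out : Type := {eq_quot inn_equivR}.

HB.instance Definition _ := Choice.on Out.
HB.instance Definition _ := EqQuotient.on Out.

Definition out_proj (a : Aut G) : Out := \pi_Out a.

Lemma out_projP a b : out_proj a = out_proj b <-> a^-1 * b \in Inn.
Proof.
have E : (out_proj a == out_proj b) = inn_equiv a b by exact: eqmodE.
by split=> [/eqP|ab]; [rewrite E | apply/eqP; rewrite E].
Qed.

Lemma out_proj_surj (u : Out) : exists a, out_proj a = u.
Proof. by exists (repr u); exact: reprK. Qed.

Definition out_one : Out := out_proj 1.
Definition out_mul (u v : Out) : Out := out_proj (repr u * repr v).
Definition out_inv (u : Out) : Out := out_proj (repr u)^-1.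

Lemma out_projM a b : out_proj (a * b) = out_mul (out_proj a) (out_proj b).
Proof.
rewrite /out_mul; set a' := repr _; set b' := repr _.
have aa' : a^-1 * a' \in Inn by apply/out_projP; rewrite /out_proj reprK.
have bb' : b^-1 * b' \in Inn by apply/out_projP; rewrite /out_proj reprK.
apply/out_projP; have -> : (a * b)^-1 * (a' * b') = (a^-1 * a') ^ b * (b^-1 * b').
  by rewrite conjgE invgM -!mulgA mulVKg.
by rewrite gpredM // Inn_normal.
Qed.

Lemma out_projV a : out_proj a^-1 = out_inv (out_proj a).
Proof.
rewrite /out_inv; set a' := repr _.
have aa' : a^-1 * a' \in Inn by apply/out_projP; rewrite /out_proj reprK.
apply/out_projP; rewrite invgK.
have -> : a * a'^-1 = ((a^-1 * a') ^ a^-1)^-1.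
  by rewrite conjgE invgK mulgA mulVKg invgM invgK.
by rewrite gpredV Inn_normal.
Qed.

Lemma out_mulA : associative out_mul.
Proof.
move=> u v w; have [a <-] := out_proj_surj u; have [b <-] := out_proj_surj v.
by have [c <-] := out_proj_surj w; rewrite -!out_projM mulgA.
Qed.

Lemma out_mul1 : left_id out_one out_mul.
Proof. by move=> u; have [a <-] := out_proj_surj u; rewrite -out_projM mul1g. Qed.

Lemma out_mulr1 : right_id out_one out_mul.
Proof. by move=> u; have [a <-] := out_proj_surj u; rewrite -out_projM mulg1. Qed.

Lemma out_mulV : left_inverse out_one out_inv out_mul.
Proof.
move=> u; have [a <-] := out_proj_surj u.
by rewrite -out_projV -out_projM mulVg.
Qed.

Lemma out_mulrV : right_inverse out_one out_inv out_mul.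
Proof.
move=> u; have [a <-] := out_proj_surj u.
by rewrite -out_projV -out_projM mulgV.
Qed.

HB.instance Definition _ :=
  isGroup.Build Out out_mulA out_mul1 out_mulr1 out_mulV out_mulrV.

HB.instance Definition _ := isMultiplicative.Build (Aut G) Out out_proj out_projM.

End OutGroup.

Arguments out_proj G : clear implicits.

(* Main.v *)
Require Import Defs.
From HB Require Import structures.
From mathcomp Require Import all_boot all_order all_algebra monoid.
From mathcomp Require Import fingroup perm pgroup cyclic.
From mathcomp Require Import Rstruct boolp reals trigo.
From mathcomp Require Import ring lra.

Set Implicit Arguments.
Unset Strict Implicit.
Unset Printing Implicit Defensive.

Import Order.TTheory GRing.Theory Num.Theory.

(** Let [G] be a finitely generated Coxeter group.

    Splitting. There is a finite subgroup [F] of [G] with finite centralizer,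
    namely a maximal finite parabolic subgroup, and [G] has finitely many
    conjugacy classes of finite subgroups ([coxeter_rigid_family]). Composing
    with an inner automorphism, one may assume that a given automorphism sends
    [F] into one fixed finite set, so the automorphisms that fix [F] pointwise
    represent a finite-index subgroup of [Out G]. The only inner ones among
    them come from the centralizer of [F], so there are finitely many. As
    [Aut G] is residually finite, some finite-index subgroup of [Aut G] avoids
    these finitely many automorphisms; intersected with the fixator of [F],
    it embeds in [Out G] with finite index ([virtual_section]), and the
    inverse of this embedding is the required section.

    Residual properties. They pass from [Aut G] to [Out G] along the section,
    and [Aut G] is virtually residually [p] for every prime [p]. Indeed [G]
    acts faithfully by matrices over a ring of algebraic integers that is
    finitely generated as an additive group, and the kernels of reduction
    modulo the powers of [p] are finite-index subgroups with trivial
    intersection that satisfy the commutator and [p]-power relations of a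
    [p]-filtration ([congruence_filtration]).
    Intersecting each with all its automorphic images makes them
    characteristic. If [H] is the first of them and an automorphism acts
    trivially on [G] modulo the subgroup generated by the commutators and the
    [p]-th powers of [H], then its [p^n]-th powers act trivially modulo deeper
    and deeper terms ([aut_virtually_residually_p]). A group that is residually
    [2] and residually [3] is torsion-free, whence the last claim.

    Finite subgroups. Both parts use the dual of the geometric representation.
    Its basic property is that every root is positive or negative
    ([root_nonneg]). A linear functional that is nonpositive on only finitely
    many positive roots can be moved into the dominant chamber by a word whose
    length is at most the number of these roots ([dominant_word]). Applied to
    the sum of an orbit of a finite subgroup, this conjugates the subgroup into
    the stabilizer of a dominant functional, whose elements have bounded length
    ([dominant_length]). *)

(** * Finite-index subgroups and finite quotients *)

Local Open Scope group_scope.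

Section Subgroups.
Variable G : groupType.
Implicit Types P Q N : G -> Prop.

Definition is_subgroup P : Prop :=
  [/\ P 1, forall x y, P x -> P y -> P (x * y) & forall x, P x -> P x^-1].

Definition is_normal P : Prop := forall x y, P x -> P (x ^ y).

(** Cosets are separated by a map to a finite type: in this form finite index
    is inherited by intersections and preimages without choosing
    representatives. *)
Definition fin_index P : Prop :=
  exists (T : finType) (f : G -> T), forall x y, f x = f y -> P (x^-1 * y).

Definition pred_of P (_ : is_subgroup P) : {pred G} := fun x => `[<P x>].

Section PredOf.
Variables (P : G -> Prop) (sP : is_subgroup P).

Lemma pred_ofP x : reflect (P x) (x \in pred_of sP).
Proof. exact: asboolP. Qed.

Lemma pred_of_mul : mulg_closed (pred_of sP).
Proof.
have [_ PM _] := sP; move=> x y /pred_ofP Px /pred_ofP Py.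
by apply/pred_ofP; apply: PM.
Qed.

Lemma pred_of1 : 1 \in pred_of sP.
Proof. by apply/pred_ofP; have [] := sP. Qed.

Lemma pred_of_inv : invg_closed (pred_of sP).
Proof.
by have [_ _ PV] := sP; move=> x /pred_ofP Px; apply/pred_ofP; apply: PV.
Qed.

HB.instance Definition _ := isMulClosed.Build G (pred_of sP) pred_of_mul.
HB.instance Definition _ := isMul1Closed.Build G (pred_of sP) pred_of1.
HB.instance Definition _ := isInvClosed.Build G (pred_of sP) pred_of_inv.

Definition classical_subgroup : groupClosed G := pred_of sP.

Lemma classical_subgroupP x : reflect (P x) (x \in classical_subgroup).
Proof. exact: pred_ofP. Qed.

End PredOf.

Lemma fin_index_finite (H : groupClosed G) :
  fin_index (fun x => x \in H) -> finite_index H.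
Proof.
case=> T [f fH].
pose r (t : T) : G :=
  if pselect (exists x, f x = t) is left e then sval (cid e) else 1.
exists [seq r t | t : T] => x; exists (r (f x)); first exact/image_f.
rewrite /r; case: pselect => [e|[]]; last by exists x.
by case: cid => y /= fy; apply: fH.
Qed.

(** Sending [x] to the position of the first representative of its coset gives
    a map whose fibres are exactly the cosets. *)
Lemma finite_index_canonical (H : groupClosed G) : finite_index H ->
  exists (T : finType) (f : G -> T),
    forall x y, f x = f y <-> x^-1 * y \in H.
Proof.
case=> ys cov.
pose a (x : G) := [pred y | y^-1 * x \in H].
have ha x : has (a x) ys by have [y yys yx] := cov x; apply/hasP; exists y.
exists 'I_(size ys), (fun x => Ordinal (etrans (esym (has_find _ _)) (ha x))).
have aE x y : x^-1 * y \in H -> a x =1 a y.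
  move=> xy z; rewrite /= -[in RHS](mulVKg x y) mulgA.
  by apply/esym; rewrite gpredMr.
move=> x y; split=> [[E]|xy]; last by apply/val_inj/eq_find/aE.
have := nth_find 1 (ha x); have := nth_find 1 (ha y); rewrite E.
move: (nth _ _ _) => z /= zy; rewrite -gpredV => zx.
by have := gpredM _ _ zx zy; rewrite invgM invgK -mulgA mulKVg.
Qed.

End Subgroups.

Section GroupMorphism.
Variables (G H : groupType) (f : {multiplicative G -> H}).

Lemma multiplicative1 : f 1 = 1.
Proof. by apply: (mulgI (f 1)); rewrite -gmulfM !mulg1. Qed.

Lemma multiplicativeX n x : f (x ^+ n) = f x ^+ n.
Proof. by elim: n => [|n IH]; rewrite ?multiplicative1 // !expgS gmulfM IH. Qed.

Lemma multiplicativeV x : f x^-1 = (f x)^-1.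
Proof. by apply: (mulgI (f x)); rewrite -gmulfM !mulgV multiplicative1. Qed.

End GroupMorphism.

Section FiniteIndex.
Variable G : groupType.
Implicit Types P Q N : G -> Prop.

Lemma fin_index_group P (sP : is_subgroup P) :
  fin_index P <-> finite_index (classical_subgroup sP).
Proof.
split=> [[T [f fP]]|/finite_index_canonical[T [f fP]]].
  by apply: fin_index_finite; exists T, f => x y /fP Pxy;
    apply/classical_subgroupP.
by exists T, f => x y /fP /classical_subgroupP.
Qed.

Lemma fin_indexI P Q :
  fin_index P -> fin_index Q -> fin_index (fun x => P x /\ Q x).
Proof.
move=> [T [f fP]] [U [g gQ]]; exists (T * U)%type, (fun x => (f x, g x)).
by move=> x y [/fP ? /gQ].
Qed.

(** [G] permutes the finitely many cosets of [N], and normality makes [N] the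
    kernel. The quotient is the image of [G] in this permutation group, which
    carries a canonical finite group structure. *)
Lemma finite_quotient N : is_subgroup N -> is_normal N -> fin_index N ->
  exists (Q : finGroupType) (phi : {multiplicative G -> Q}),
    (forall q, exists x, phi x = q) /\ forall x, phi x = 1 <-> N x.
Proof.
move=> sN nN /(fin_index_group sN)/finite_index_canonical[T [f fE]].
have fN x y : f x = f y <-> N (x^-1 * y).
  by rewrite fE; split=> [/classical_subgroupP|?];
    last exact/classical_subgroupP.
have [N1 NM NV] := sN.
pose X := {t : T | `[< exists x, f x = t >]}.
have rP (t : X) : {x | f x = val t} by case: t => t /= /asboolP /cid.
pose r t := sval (rP t).
have fr t : f (r t) = val t by rewrite /r; case: (rP t).
pose cl x : X := Sub (f x) (asboolT (ex_intro _ x erefl)).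
have clE x y : cl x = cl y <-> N (x^-1 * y).
  by rewrite -fN; split=> [/(congr1 val)|fxy] //; apply: val_inj.
have rcl x : N (x^-1 * r (cl x)) by rewrite -fN fr.
have clr t : cl (r t) = t by apply: val_inj; rewrite /= fr.
(* The inverse makes up for permutations being composed from left to right. *)
pose s a t := cl (a^-1 * r t).
have sM a b t : s (a * b) t = s b (s a t).
  apply/clE; rewrite invgM !invgM !invgK !mulgA -[_ * a * b]mulgA.
  have := rcl (a^-1 * r t); rewrite invgM invgK => Nr.
  by rewrite -!mulgA mulVKg !mulgA.
have s1 t : s 1 t = t by rewrite /s invg1 mul1g clr.
have s_inj a : injective (s a).
  by apply: (can_inj (g := s a^-1)) => t; rewrite -sM mulgV s1.
pose pi a := perm (@s_inj a).
have piM : {morph pi : a b / a * b}.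
  by move=> a b; apply/permP=> t; rewrite permM !permE sM.
pose I := [set q | `[< exists a, pi a = q >]].
have gI : group_set I.
  apply/group_setP; split.
    rewrite inE; apply/asboolP; exists 1.
    by apply/permP=> t; rewrite permE perm1 s1.
  move=> u v; rewrite !inE => /asboolP[a <-] /asboolP[b <-].
  by apply/asboolP; exists (a * b); rewrite piM.
pose Q := subg_of (Group gI).
have piI a : pi a \in Group gI by rewrite inE; apply/asboolP; exists a.
pose phi a : Q := Subg (piI a).
have phiM : {morph phi : a b / a * b}.
  by move=> a b; apply: val_inj; rewrite /= piM.
pose phiH := isMultiplicative.Build G Q phi phiM.
pose phi' : {multiplicative G -> Q} := HB.pack phi phiH.
exists Q, phi'; split=> [[q qI]|x].
  have := qI; rewrite inE => /asboolP[a aq]; exists a.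
  by apply: val_inj.
have phi1 : phi x = 1 <-> pi x = 1.
  by split=> [/(congr1 val)|E]; last apply: val_inj.
rewrite [phi' x]/(phi x) phi1; split=> [/permP|Nx].
  move=> /(_ (cl 1)); rewrite permE perm1 -{2}[cl 1]clr => /clE.
  rewrite invgM invgK -mulgA => /nN-/(_ (r (cl 1))^-1).
  by rewrite -conjgE conjgK.
apply/permP=> t; rewrite permE perm1 -{2}[t]clr; apply/clE.
by rewrite invgM invgK -mulgA; apply: nN.
Qed.

(** By Cauchy's theorem a prime divisor of the order is the order of some
    element. *)
Lemma pgroup_exponent (p : nat) (Q : finGroupType) : prime p ->
  (forall q : Q, exists k, q ^+ (p ^ k) = 1) -> p.-group [set: Q].
Proof.
move=> pp expQ; apply/pgroupP=> q qp /(Cauchy qp)[x _ ox].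
have [k /eqP] := expQ x; rewrite -order_dvdn ox Euclid_dvdX // dvdn_prime2 //.
by case/andP.
Qed.

Lemma residually_p_of_subgroups (p : nat) : prime p ->
  (forall x, x <> 1 -> exists N : G -> Prop,
    [/\ is_subgroup N, is_normal N, fin_index N, ~ N x
      & forall y, exists k, N (y ^+ (p ^ k))]) ->
  residually_p p G.
Proof.
move=> pp sepG x /sepG[N [sN nN fN Nx expN]].
have [Q [phi [surj phi1]]] := finite_quotient sN nN fN.
exists Q, phi; split=> //; last by rewrite phi1.
apply: pgroup_exponent pp _ => q; have [y <-] := surj q; have [k Ny] := expN y.
by exists k; rewrite -multiplicativeX; apply/phi1.
Qed.

End FiniteIndex.

(** If [x ^+ n = 1], the power of [x] by the [p]-part of [n] has order prime to
    [p], so it dies in every finite [p]-group and is trivial. Hence the order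
    of [x] is a power of [p]; the same argument with [q] makes it [1]. *)
Lemma torsion_free_residually_p (G : groupType) (p q : nat) :
  prime p -> prime q -> p != q ->
  residually_p p G -> residually_p q G -> torsion_free G.
Proof.
have step (r n : nat) (x : G) : prime r -> residually_p r G ->
    (0 < n)%N -> x ^+ n = 1 -> x ^+ (n`_r) = 1.
  move=> rp resr n_gt0 xn; apply: contrapT => /resr[Q [phi [rQ _]]]; apply.
  have [k oy] := p_natP (mem_p_elt rQ (in_setT (phi (x ^+ n`_r)))).
  have: (#[phi (x ^+ n`_r)] %| n`_r^')%N.
    by rewrite order_dvdn -multiplicativeX -expgnA partnC // xn multiplicative1.
  move/(pnat_dvd) => /(_ r^' (part_pnat _ _)) r'o; apply/eqP.
  rewrite -order_eq1; apply/eqP/(pnat_1 _ r'o).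
  by rewrite oy pnatX pnat_id.
move=> pp qp pq resp resq x n n_gt0 /(step _ _ _ pp resp n_gt0)-xp.
have := step _ _ _ qp resq (part_gt0 _ _) xp.
rewrite part_p'nat ?expg1 //.
by apply: sub_in_pnat (part_pnat p n) => r _ /eqP->; rewrite !inE.
Qed.

(** * Generators of finite-index subgroups *)

Section Generation.
Variable G : groupType.
Implicit Types P H L : G -> Prop.

Definition generated_by H (gs : seq G) : Prop :=
  (forall g, g \in gs -> H g) /\
  forall P, is_subgroup P -> (forall g, g \in gs -> P g) ->
    forall x, H x -> P x.

Lemma finitely_generatedP :
  finitely_generated G -> exists gs, generated_by (fun=> True) gs.
Proof.
case=> gs gsG; exists gs; split=> // P sP gsP x _.
by apply/(classical_subgroupP sP)/gsG => g /gsP /(classical_subgroupP sP).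
Qed.

Lemma is_subgroupI P H :
  is_subgroup P -> is_subgroup H -> is_subgroup (fun x => P x /\ H x).
Proof.
move=> [P1 PM PV] [H1 HM HV]; split=> // [x y [? ?] [? ?]|x [? ?]].
  by split; [exact: PM | exact: HM].
by split; [exact: PV | exact: HV].
Qed.

(** Schreier's argument. If [T] is a finite set of coset representatives and
    [P] the subgroup generated by the elements [r^-1 s t] that rewrite [s t]
    as a representative [r], then [T P] is stable under left multiplication by
    the generators, hence is all of [G]. Taking into the generating set the
    representatives that happen to lie in [H] avoids normalizing [T]. *)
Lemma finite_index_generated H : finitely_generated G ->
  is_subgroup H -> fin_index H -> exists hs, generated_by H hs.
Proof.
move=> /finitely_generatedP[gs [_ gsG]] sH [T [f fH]].
have [H1 HM HV] := sH.
pose r t := if pselect (exists x, f x = t) is left e then sval (cid e) else 1.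
have rH x : H ((r (f x))^-1 * x).
  rewrite /r; case: pselect => [e|[]]; last by exists x.
  by case: cid => y /= fy; apply: fH.
pose ys := 1 :: [seq r t | t : T].
have rys x : r (f x) \in ys by rewrite inE image_f ?orbT.
pose S := gs ++ [seq g^-1 | g <- gs].
pose sg s t := (r (f (s * t)))^-1 * (s * t).
exists ([seq sg s t | s <- S, t <- ys] ++ [seq y <- ys | `[< H y >]]).
split=> [g|P sP gsP].
  rewrite mem_cat mem_filter => /orP[/allpairsP[[s t] /= [_ _ ->]]|].
    exact: rH.
  by case/andP => /asboolP.
have {}sP : is_subgroup (fun x => P x /\ H x) by exact: is_subgroupI.
have sgP s t : s \in S -> t \in ys -> P (sg s t) /\ H (sg s t).
  by move=> sS tys; split; [apply: gsP; rewrite mem_cat allpairs_f | apply: rH].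
have ysP y : y \in ys -> H y -> P y.
  by move=> yys Hy; apply: gsP; rewrite mem_cat mem_filter yys asboolT ?orbT.
set Q := fun x => P x /\ H x in sP sgP; have [Q1 QM QV] := sP.
(* The union of the cosets of the new subgroup at the representatives. *)
pose X x := exists2 t, t \in ys & Q (t^-1 * x).
have XS s x : s \in S -> X x -> X (s * x).
  move=> sS [t tys Qtx]; exists (r (f (s * t))) => //.
  by have := QM _ _ (sgP s t sS tys) Qtx; rewrite /sg -!mulgA mulVKg.
pose W g := forall x, X x -> X (g * x) /\ X (g^-1 * x).
have sW : is_subgroup W.
  split=> [x|g h Wg Wh x Xx|g Wg x /Wg[]]; last by rewrite invgK.
    by rewrite invg1 mul1g.
  rewrite invgM -!mulgA; split; first by case/Wh: Xx => /Wg[].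
  by case/Wg: Xx => _ /Wh[].
have gsW g : g \in gs -> W g.
  move=> ggs x Xx; split; apply: XS => //; rewrite mem_cat ?ggs //.
  by rewrite map_f ?orbT.
have X1 : X 1 by exists 1; rewrite ?mem_head // mulVg.
move=> x Hx; have [] := gsG W sW gsW x I 1 X1.
rewrite mulg1 => -[t tys [Ptx Htx]] _.
have Ht : H t.
  by have := HM _ _ Hx (HV _ Htx); rewrite invgM invgK mulKVg.
have [_ PM _] := sP.
by have [] := PM _ _ (conj (ysP t tys Ht) Ht) (conj Ptx Htx); rewrite mulVKg.
Qed.

(** Modulo [L] the group [H] is abelian of exponent [p] and finitely generated,
    hence finite. The induction adds one generator [g] at a time: if finitely
    many cosets of [L] form a subgroup [P], so do the [g^e P] with [e < p]. *)
Lemma fin_index_elementary_abelian (p : nat) H L (hs : seq G) : (0 < p)%N ->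
  is_subgroup H -> fin_index H -> generated_by H hs ->
  is_subgroup L -> (forall x, L x -> H x) ->
  (forall x y, H x -> H y -> L [~ x, y]) -> (forall x, H x -> L (x ^+ p)) ->
  fin_index L.
Proof.
move=> p_gt0 sH [T [f fH]] [hsH hsgen] sL LH LR LX.
have [H1 HM HV] := sH; have [L1 LM LV] := sL.
have HX n x : H x -> H (x ^+ n).
  by move=> Hx; elim: n => // n IH; rewrite expgS; apply: HM.
pose C (ys : seq G) x := H x /\ exists2 y, y \in ys & L (y^-1 * x).
have [ys [sC hsC]] :
    exists ys, is_subgroup (C ys) /\ forall h, h \in hs -> C ys h.
  elim: hs hsH {hsgen} => [_|g hs IH gsH].
    exists [:: 1]; split=> //.
    have CE x : C [:: 1] x <-> L x.
      split=> [[_ [y]]|Lx]; first by rewrite inE => /eqP->; rewrite invg1 mul1g.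
      by split; [exact: LH | exists 1; rewrite ?mem_head // invg1 mul1g].
    by split=> [|x y /CE ? /CE ?|x /CE ?]; apply/CE => //;
      [exact: LM|exact: LV].
  have [|ys [sP hsP]] := IH; first by move=> h hhs; apply: gsH;
    rewrite inE hhs orbT.
  have Hg : H g by apply: gsH; rewrite mem_head.
  set P := C ys in sP hsP; have [P1 PM PV] := sP.
  have PH x : P x -> H x by case.
  have LP x : L x -> P x.
    move=> Lx; have [_ [y yys Ly]] := P1; split; first exact: LH.
    by exists y => //; have := LM _ _ Ly Lx; rewrite mulg1.
  have PJ x h : P x -> H h -> P (x ^ h).
    move=> Px Hh; rewrite -(mulVKg x (x ^ h)) -commgEl.
    by apply: PM => //; apply/LP/LR => //; apply: PH.
  pose zs := [seq g ^+ e * y | e <- iota 0 p, y <- ys]; exists zs.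
  have CE x : C zs x <-> exists e, P (g ^- e * x).
    split=> [[Hx [_ /allpairsP[[e y] /= [_ yys ->]]]]|[e Pex]].
      rewrite invgM -mulgA => Lx; exists e; split; last by exists y.
      by apply: HM => //; apply/HV/HX.
    have Hx : H x.
      by rewrite -(mulVKg (g ^+ e) x); apply: HM; [exact: HX | exact: PH].
    split=> //.
    have: P (g ^- (e %% p) * x).
      have -> : g ^- (e %% p) * x = (g ^+ p) ^+ (e %/ p) * (g ^- e * x).
        rewrite {3}(divn_eq e p) addnC expgnDr mulnC expgnA invgM.
        by rewrite !mulgA mulgV mul1g.
      apply: (PM _ _) => //; elim: (e %/ p) => // n IHn.
      by rewrite expgS; apply: PM => //; apply/LP/LX.
    case=> _ [y yys Ly]; exists (g ^+ (e %% p) * y).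
      by apply: allpairs_f => //; rewrite mem_iota add0n ltn_mod.
    by rewrite invgM -mulgA.
  split.
    split=> [|x y /CE[e Px] /CE[d Py]|x /CE[e Px]]; apply/CE.
    - by exists 0%N; rewrite expg0 invg1 mul1g.
    - exists (e + d)%N.
      have := PM _ _ (PJ _ _ Px (HX d _ Hg)) Py.
      rewrite conjgE expgnDr invgM -!mulgA.
      by rewrite mulVKg !mulgA.
    exists (e * p.-1)%N.
    have -> : g ^- (e * p.-1) * x^-1 =
              (g ^+ e) ^- p * ((g ^- e * x)^-1 ^ (g ^- e)).
      rewrite conjgE invgM !invgK !mulgA mulgK -{2}(prednK p_gt0) expgS invgM.
      by rewrite mulgVK expgnA.
    apply: PM; first exact/PV/LP/LX/HX.
    by apply: PJ; [exact: PV | exact/HV/HX].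
  have gP x : P x -> C zs x.
    by move=> Px; apply/CE; exists 0%N; rewrite expg0 invg1 mul1g.
  move=> h; rewrite inE => /predU1P[->|/hsP]; last exact: gP.
  by apply/CE; exists 1%N; rewrite expg1 mulVg.
pose r t := if pselect (exists x, f x = t) is left e then sval (cid e) else 1.
have rC x : C ys ((r (f x))^-1 * x).
  apply: hsgen => //; rewrite /r; case: pselect => [e|[]]; last by exists x.
  by case: cid => y /= fy; apply: fH.
have iC x : {i : 'I_(size ys) | L ((nth 1 ys i)^-1 * ((r (f x))^-1 * x))}.
  apply: cid; have [_ [y yys Ly]] := rC x.
  by exists (Ordinal (etrans (index_mem y ys) yys)); rewrite /= nth_index.
exists (T * 'I_(size ys))%type, (fun x => (f x, sval (iC x))) => x y [fxy].
case: (iC x) (iC y) => i /= Lx [j /= Ly] ij; move: Ly; rewrite -fxy -ij.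
by move/(LM _ _ (LV _ Lx)); rewrite !invgM !invgK -!mulgA !mulVKg.
Qed.

End Generation.

(** * Automorphisms of a group with a p-filtration *)

Section Commutators.
Variables (G : groupType) (x y z : G).

Lemma commMgJ : [~ x * y, z] = [~ x, z] ^ y * [~ y, z].
Proof. by rewrite !commgEl !conjgE !invgM -!mulgA !mulVKg. Qed.

Lemma commgMJ : [~ x, y * z] = [~ x, z] * [~ x, y] ^ z.
Proof. by rewrite !commgEl !conjgE !invgM -!mulgA !mulVKg. Qed.

End Commutators.

Section Automorphisms.
Variable G : groupType.
Implicit Types (a b : Aut G) (N P : G -> Prop).

Lemma autf1 a : a 1 = 1.
Proof. by apply: (mulgI (a 1)); rewrite -aut_morph !mulg1. Qed.

Lemma autfV a x : a x^-1 = (a x)^-1.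
Proof. by apply: (mulgI (a x)); rewrite -aut_morph !mulgV autf1. Qed.

Lemma autfX a n x : a (x ^+ n) = a x ^+ n.
Proof. by elim: n => [|n IH]; rewrite ?autf1 // !expgS aut_morph IH. Qed.

Lemma autfR a x y : a [~ x, y] = [~ a x, a y].
Proof. by rewrite !commgEl !conjgE !aut_morph !autfV. Qed.

Lemma autVf a x : a^-1 (a x) = x.
Proof. by rewrite -autM mulVg. Qed.

Lemma inner_morph g : {morph (fun x : G => g * x * g^-1) : x y / x * y}.
Proof. by move=> x y; rewrite !mulgA mulgVK. Qed.

Lemma inner_bij g : bijective (fun x : G => g * x * g^-1).
Proof.
by exists (fun x : G => g^-1 * x * g) => x;
  rewrite !mulgA ?mulgK ?mulgVK ?mulVg ?mulgV mul1g.
Qed.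

Definition inner g : Aut G := MkAut (inner_morph g) (inner_bij g).

Lemma inner_Inn g : inner g \in @Inn G.
Proof. by apply/InnP; exists g. Qed.

Definition is_char N : Prop := forall a x, N x -> N (a x).

Lemma char_normal N : is_char N -> is_normal N.
Proof. by move=> cN x y /(cN (inner y^-1)); rewrite /= invgK -mulgA. Qed.

(** The automorphisms that act trivially on the cosets of [N]. *)
Definition aut_stab N a : Prop := forall x, N (x^-1 * a x).

Lemma aut_stab_subgroup N :
  is_subgroup N -> is_char N -> is_subgroup (aut_stab N).
Proof.
move=> [N1 NM NV] cN; split=> [x|a b Na Nb x|a Na x].
- by rewrite mulVg.
- by rewrite autM -(mulVKg (a x) (a (b x))) mulgA -autfV -aut_morph;
  apply/NM/cN.
have := cN a^-1 _ (NV _ (Na x)).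
by rewrite invgM invgK aut_morph autfV autVf.
Qed.

Lemma aut_stab_normal N : is_char N -> is_normal (aut_stab N).
Proof.
move=> cN a b Na x; rewrite conjgE !autM.
by have := cN b^-1 _ (Na (b x)); rewrite aut_morph autfV autVf.
Qed.

Lemma agree_mod_subgroup N a b : is_subgroup N -> is_normal N ->
  is_subgroup (fun x => N ((a x)^-1 * b x)).
Proof.
move=> [N1 NM NV] nN; split=> [|x y Nx Ny|x Nx].
- by rewrite !autf1 mulVg.
- rewrite !aut_morph invgM.
  have -> : (a y)^-1 * (a x)^-1 * (b x * b y) =
    ((a x)^-1 * b x) ^ a y * ((a y)^-1 * b y).
    by rewrite conjgE -!mulgA mulVKg.
  exact/NM/Ny/nN.
have := nN _ (a x)^-1 (NV _ Nx); rewrite conjgE !invgM !invgK !autfV invgK.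
by rewrite -!mulgA mulgV mulg1.
Qed.

(** Modulo a characteristic subgroup an automorphism is determined by its
    values on finitely many generators. *)
Lemma fin_index_aut_stab N : finitely_generated G ->
  is_subgroup N -> is_char N -> fin_index N -> fin_index (aut_stab N).
Proof.
move=> /finitely_generatedP[gs [_ gsG]] sN cN [T [f fN]].
exists {ffun 'I_(size gs) -> T},
  (fun a => [ffun i : 'I_(size gs) => f (a (nth 1 gs i))]).
move=> a b /ffunP ab x.
have := cN a^-1; rewrite autM => /(_ ((a x)^-1 * b x)).
rewrite aut_morph autfV autVf; apply.
apply: (gsG _ (agree_mod_subgroup a b sN (char_normal cN))) I => g ggs.
have igs : (index g gs < size gs)%N by rewrite index_mem.
by apply: fN; have := ab (Ordinal igs); rewrite !ffunE /= nth_index.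
Qed.

Definition char_core N x : Prop := forall a, N (a x).

Lemma char_core_sub N x : char_core N x -> N x.
Proof. by move/(_ 1). Qed.

Lemma char_core_char N : is_char (char_core N).
Proof. by move=> a x Nx b; apply: (Nx (b * a)). Qed.

Lemma char_core_subgroup N : is_subgroup N -> is_subgroup (char_core N).
Proof.
move=> [N1 NM NV]; split=> [a|x y Nx Ny a|x Nx a].
- by rewrite autf1.
- by rewrite aut_morph; apply: NM.
by rewrite autfV; apply: NV.
Qed.

(** The images of [N] under all automorphisms are finitely many in effect: the
    composite of an automorphism with the projection modulo [N] depends only on
    the images of the generators, for which finitely many choices exist. *)
Lemma fin_index_char_core N : finitely_generated G ->
  is_subgroup N -> is_normal N -> fin_index N -> fin_index (char_core N).
Proof.
move=> /finitely_generatedP[gs [_ gsG]] sN nN [T [f fN]].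
pose K := {ffun 'I_(size gs) -> T}.
pose c (a : Aut G) : K := [ffun i : 'I_(size gs) => f (a (nth 1 gs i))].
pose r (t : K) :=
  if pselect (exists a, c a = t) is left e then sval (cid e) else 1.
exists {ffun K -> T}, (fun x => [ffun t => f (r t x)]) => x y /ffunP xy a.
have [_ NM _] := sN.
have Nxy : N (r (c a) (x^-1 * y)).
  by have := xy (c a); rewrite !ffunE aut_morph autfV; apply: fN.
rewrite -(mulVKg (r (c a) (x^-1 * y)) (a _)); apply: NM => //.
have /ffunP ca : c (r (c a)) = c a.
  by rewrite /r; case: pselect => [e|[]]; [case: cid | exists a].
apply: (gsG _ (agree_mod_subgroup _ _ sN nN)) I => g ggs.
have igs : (index g gs < size gs)%N by rewrite index_mem.
by apply: fN; have := ca (Ordinal igs); rewrite !ffunE /= nth_index.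
Qed.

End Automorphisms.

(** The commutator rule is that of a central series whose first term has index
    [0], whence the shift by one. *)
Definition p_filtration (p : nat) (G : groupType) (F : nat -> G -> Prop) :
    Prop :=
  [/\ forall n, is_subgroup (F n),
      forall n x, F n.+1 x -> F n x,
      forall i j x y, F i x -> F j y -> F (i + j).+1 [~ x, y]
    & forall i x, F i x -> F i.+1 (x ^+ p)].

Section SmallestFiltration.
Variables (p : nat) (G : groupType) (H : G -> Prop).

(** The smallest [p]-filtration that starts at [H]. As an inductive predicate
    it provides an induction over the way in which an element arises from [H];
    such an induction shows that the action of an automorphism on the first
    quotient controls its action on all the others. *)
Inductive pseries : nat -> G -> Prop :=
| pseries_base x : H x -> pseries 0 x
| pseries1 n : pseries n 1
| pseriesM n x y : pseries n x -> pseries n y -> pseries n (x * y)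
| pseriesV n x : pseries n x -> pseries n x^-1
| pseries_weak n x : pseries n.+1 x -> pseries n x
| pseriesR i j x y :
    pseries i x -> pseries j y -> pseries (i + j).+1 [~ x, y]
| pseriesX i x : pseries i x -> pseries i.+1 (x ^+ p).

Lemma pseries_subgroup n : is_subgroup (pseries n).
Proof. by split; [exact: pseries1 | exact: pseriesM | exact: pseriesV]. Qed.

Lemma pseries_leq m n x : (m <= n)%N -> pseries n x -> pseries m x.
Proof.
move/subnK <-; elim: (n - m)%N => // k IH.
by rewrite addSn => /pseries_weak.
Qed.

Lemma pseries_min (F : nat -> G -> Prop) : p_filtration p F ->
  (forall x, H x -> F 0%N x) -> forall n x, pseries n x -> F n x.
Proof.
move=> [sF wF RF XF] HF n x; elim=> {n x}; first exact: HF.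
- by move=> n; have [] := sF n.
- by move=> n x y _ Fx _ Fy; have [_ FM _] := sF n; apply: FM.
- by move=> n x _ Fx; have [_ _ FV] := sF n; apply: FV.
- by move=> n x _; apply: wF.
- by move=> i j x y _ Fx _; apply: RF.
by move=> i x _; apply: XF.
Qed.

Lemma pseriesJ n i x y : pseries n x -> pseries i y -> pseries n (x ^ y).
Proof.
move=> Sx Sy; rewrite -(mulVKg x (x ^ y)) -commgEl; apply: pseriesM => //.
by apply: pseries_leq (pseriesR Sx Sy); rewrite leqW ?leq_addr.
Qed.

Lemma pseriesXn n k x : pseries n x -> pseries n (x ^+ k).
Proof.
by move=> Sx; elim: k => [|k IH];
  [exact: pseries1 | rewrite expgS; apply: pseriesM].
Qed.

Hypothesis charH : is_char H.

Lemma pseries_char n : is_char (pseries n).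
Proof.
move=> a x; elim=> {n x}.
- by move=> x Hx; apply/pseries_base/charH.
- by move=> n; rewrite autf1; apply: pseries1.
- by move=> n x y _ ? _ ?; rewrite aut_morph; apply: pseriesM.
- by move=> n x _ ?; rewrite autfV; apply: pseriesV.
- by move=> n x _; apply: pseries_weak.
- by move=> i j x y _ ? _ ?; rewrite autfR; apply: pseriesR.
by move=> i x _ ?; rewrite autfX; apply: pseriesX.
Qed.

(** On generators of the next layer: if [a] multiplies [x] and [y] by factors
    one layer deeper than they are, then it changes their commutator, or a
    [p]-th power, by a product of conjugates of commutators and [p]-th powers
    that involve these factors, hence lie one layer deeper as well. *)
Lemma pseries_stab (a : Aut G) : aut_stab (pseries 1) a ->
  forall n x, pseries n x -> pseries n.+1 (x^-1 * a x).
Proof.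
move=> a1 n x; elim=> {n x}.
- by move=> x _; apply: a1.
- by move=> n; rewrite autf1 mulVg; apply: pseries1.
- move=> n x y _ IHx Sy IHy.
  have -> : (x * y)^-1 * a (x * y) = (x^-1 * a x) ^ y * (y^-1 * a y).
    by rewrite aut_morph conjgE invgM -!mulgA mulVKg.
  exact/pseriesM/IHy/(pseriesJ IHx Sy).
- move=> n x Sx IHx.
  have -> : x^-1^-1 * a x^-1 = (x^-1 * a x)^-1 ^ x^-1.
    by rewrite autfV conjgE invgM !invgK -!mulgA mulgV mulg1.
  exact/(pseriesJ _ (pseriesV Sx))/pseriesV/IHx.
- by move=> n x _; apply: pseries_weak.
- move=> i j x y Sx; set c := x^-1 * a x => Sc Sy; set d := y^-1 * a y => Sd.
  have -> : a [~ x, y] = [~ x * c, y * d] by rewrite autfR !mulVKg.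
  clearbody c d.
  have -> : [~ x * c, y * d] = ([~ x, d] * [~ x, y] ^ d) ^ c * [~ c, y * d].
    by rewrite commMgJ commgMJ.
  set u := [~ x, y]; have Su : pseries (i + j).+1 u by apply: pseriesR.
  clearbody u.
  have -> : u^-1 * (([~ x, d] * u ^ d) ^ c * [~ c, y * d]) =
      ([~ x, d] ^ c) ^ u * [~ u, d * c] * [~ c, y * d].
    by rewrite conjMg -(conjgM u d c) [_ ^ u]conjgE (commgEl u) -!mulgA !mulVKg.
  have Sd0 := pseries_leq (leq0n j.+1) Sd.
  have Sc0 := pseries_leq (leq0n i.+1) Sc.
  apply: pseriesM; first apply: pseriesM.
  - by apply: pseriesJ Su; apply: pseriesJ Sc; rewrite -addnS; apply: pseriesR.
  - by rewrite -[(i + j).+1]addn0; apply/pseriesR/pseriesM.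
  by rewrite -addSn; apply/pseriesR/pseriesM/pseries_weak.
- move=> i x Sx; set c := x^-1 * a x => Sc.
  have -> : a (x ^+ p) = (x * c) ^+ p by rewrite autfX mulVKg.
  clearbody c.
  have Sn k : pseries i.+2 ((x ^+ k * c ^+ k)^-1 * (x * c) ^+ k).
    elim: k => [|k IH]; first by rewrite !expg0 !mulg1 invg1; apply: pseries1.
    have -> : (x ^+ k.+1 * c ^+ k.+1)^-1 * (x * c) ^+ k.+1 =
        ([~ c ^+ k, x] * ((x ^+ k * c ^+ k)^-1 * (x * c) ^+ k) ^ x) ^ c.
      rewrite !expgSr commgEl !conjgE !invgM -!mulgA.
      by rewrite !mulVKg.
    apply: pseriesJ (Sc); apply: pseriesM (pseriesJ IH Sx).
    by apply: pseries_leq (pseriesR (pseriesXn k Sc) Sx);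
      rewrite !ltnS leq_addr.
  rewrite -(mulVKg (x ^+ p * c ^+ p) ((x * c) ^+ p)) -!mulgA mulKg.
  exact/pseriesM/Sn/pseriesX.
Qed.

(** Write [a g = g c]. As [a] moves the powers of [c] only in the next layer,
    [a^k g] is [g c^k] modulo that layer, and [c^p] lies in it. *)
Lemma pseries_stabX (a : Aut G) n : aut_stab (pseries 1) a ->
  aut_stab (pseries n.+1) a -> aut_stab (pseries n.+2) (a ^+ p).
Proof.
move=> a1 an g; have := an g; set c := g^-1 * a g => Sc.
have ag : a g = g * c by rewrite mulVKg.
clearbody c.
have Sm k : pseries n.+2 ((g * c ^+ k)^-1 * (a ^+ k) g).
  elim: k => [|k IH]; first by rewrite !expg0 mulg1 mulVg; apply: pseries1.
  have := pseries_char a IH; rewrite aut_morph autfV -autM -expgS.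
  have Sck : pseries n.+2 ((c ^+ k)^-1 * a (c ^+ k)).
    exact/(pseries_stab a1)/pseriesXn.
  move/(pseriesM Sck); rewrite aut_morph ag !expgS.
  by rewrite !invgM -!mulgA mulVKg.
have := Sm p; rewrite invgM -mulgA => /(pseriesM (pseriesX Sc)).
by rewrite mulVKg.
Qed.

Lemma aut_stab_pseriesX (a : Aut G) n : aut_stab (pseries 1) a ->
  aut_stab (pseries n.+1) (a ^+ (p ^ n)).
Proof.
move=> a1; elim: n => [|n IH]; first by rewrite expn0 expg1.
rewrite expnSr expgnA; apply: pseries_stabX => //.
have [S1 SM SV] :=
  aut_stab_subgroup (pseries_subgroup 1) (pseries_char (n := 1)).
by elim: (p ^ n)%N => [|k IHk]; rewrite ?expg0 // expgS; apply: SM.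
Qed.

End SmallestFiltration.

Lemma char_core_filtration p (G : groupType) (F : nat -> G -> Prop) :
  p_filtration p F -> p_filtration p (fun n => char_core (F n)).
Proof.
case=> sF wF RF XF; split=> [n|n x Fx a|i j x y Fx Fy a|i x Fx a].
- exact: char_core_subgroup.
- exact: wF.
- by rewrite autfR; apply: RF.
by rewrite autfX; apply: XF.
Qed.

(** The group [A0] consists of the automorphisms that act trivially modulo the
    second term of the smallest [p]-filtration starting at the characteristic
    core of [F 0], and [A n] of those that act trivially modulo the core of
    [F n]. That [A0] has finite index relies on the finite generation of the
    core: its elementary abelian [p]-quotient is finite. *)
Theorem aut_virtually_residually_p p (G : groupType) (F : nat -> G -> Prop) :
  (0 < p)%N -> finitely_generated G -> p_filtration p F ->
  (forall n, is_normal (F n)) -> (forall n, fin_index (F n)) ->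
  (forall x, (forall n, F n x) -> x = 1) ->
  exists (A0 : Aut G -> Prop) (A : nat -> Aut G -> Prop),
    [/\ is_subgroup A0 /\ fin_index A0,
        forall n, [/\ is_subgroup (A n), is_normal (A n) & fin_index (A n)],
        forall a, (forall n, A n a) -> a = 1
      & forall a n, A0 a -> exists k, A n (a ^+ (p ^ k))].
Proof.
move=> p_gt0 fgG filF nF fF capF.
pose K n := char_core (F n).
have filK : p_filtration p K := char_core_filtration filF.
have [sK wK RK XK] := filK.
have cK n : is_char (K n) := char_core_char (N := F n).
have fK n : fin_index (K n) by apply: fin_index_char_core; case: filF.
have SK n x : pseries p (K 0%N) n x -> K n x by apply: pseries_min.
have fS : fin_index (pseries p (K 0%N) 1).
  have [hs Khs] := finite_index_generated fgG (sK 0%N) (fK 0%N).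
  apply: (fin_index_elementary_abelian p_gt0 (sK 0%N) (fK 0%N) Khs).
  - exact: pseries_subgroup.
  - by move=> x /SK /wK.
  - move=> x y Kx Ky; rewrite -[1%N]/((0 + 0).+1)%N.
    by apply: pseriesR; apply: pseries_base.
  by move=> x Kx; apply/pseriesX/pseries_base.
exists (aut_stab (pseries p (K 0%N) 1)), (fun n => aut_stab (K n)); split.
- have cS := pseries_char (p := p) (cK 0%N) (n := 1).
  split; first exact/aut_stab_subgroup/cS/pseries_subgroup.
  by apply: fin_index_aut_stab cS fS => //; apply: pseries_subgroup.
- move=> n; split; first exact: aut_stab_subgroup (sK n) (cK n).
    exact: aut_stab_normal (cK n).
  exact: fin_index_aut_stab fgG (sK n) (cK n) (fK n).
- move=> a Aa; apply: autP => x; rewrite -(mulVKg x (a x)).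
  by rewrite (capF (x^-1 * a x)) ?mulg1 // => n;
    exact: (char_core_sub (Aa n x)).
move=> a n Aa; exists n => x.
exact/wK/SK/(aut_stab_pseriesX (cK 0%N) n Aa).
Qed.

(** * Sections of the projection onto outer automorphisms *)

Definition has_p_filtrations (G : groupType) : Prop :=
  forall p : nat, prime p -> exists F : nat -> G -> Prop,
    [/\ p_filtration p F, forall n, is_normal (F n), forall n, fin_index (F n)
      & forall x, (forall n, F n x) -> x = 1].

(** [F] plays the part of a finite subgroup, [C] bounds its centralizer, and
    [E] is a finite set that contains a conjugate of every image of [F] under
    an automorphism. *)
Definition rigid_family (G : groupType) (F E C : seq G) : Prop :=
  (forall g, {in F, forall f, g * f = f * g} -> g \in C) /\
  (forall a : Aut G, exists g, {in F, forall f, g * a f * g^-1 \in E}).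

Section VirtualSection.
Variables (G : groupType) (F E C : seq G).
Hypothesis rigidF : rigid_family F E C.
Implicit Types (N : Aut G -> Prop).

Definition fixes_family (a : Aut G) : Prop := {in F, forall f, a f = f}.

Lemma fixes_family_subgroup : is_subgroup fixes_family.
Proof.
split=> [f _ //|a b Fa Fb f fF|a Fa f fF]; first by rewrite autM Fb // Fa.
by rewrite -{1}(Fa f fF) autVf.
Qed.

Definition avoids_inner N : Prop :=
  forall a, a \in @Inn G -> fixes_family a -> N a -> a = 1.

Lemma avoids_innerP N :
  (forall c, c \in C -> N (inner c) -> inner c = 1) -> avoids_inner N.
Proof.
move=> NC a /InnP[g ag] Fa Na; have [FC _] := rigidF.
have -> : a = inner g by apply: autP.
apply: NC; last by rewrite (_ : inner g = a) //; apply: autP => x; rewrite ag.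
by apply: FC => f fF; rewrite -{2}(Fa f fF) ag mulgVK.
Qed.

Lemma out_proj_inner g : out_proj G (inner g) = 1.
Proof. by apply/out_projP; rewrite mulg1 gpredV inner_Inn. Qed.

Lemma out_mulE (a b : Aut G) : out_proj G (a * b) = out_proj G a * out_proj G b.
Proof. exact: out_projM. Qed.

Lemma out_mulV (a : Aut G) : out_proj G a^-1 = (out_proj G a)^-1.
Proof. exact: out_projV. Qed.

(** Every outer class has a representative that sends [F] into [E]; its class
    is then located by the restriction to [F], for which there are finitely
    many possibilities, together with the coset modulo [N]. *)
Lemma fin_index_out_image N : fin_index N ->
  fin_index (fun u => exists a, [/\ fixes_family a, N a & out_proj G a = u]).
Proof.
move=> [T [f fN]]; have [_ FE] := rigidF.
have /choice[b bP] u : exists b : Aut G,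
    out_proj G b = u /\ {in F, forall x, b x \in E}.
  have [a <-] := out_proj_surj u; have [g gE] := FE a.
  by exists (inner g * a); rewrite out_mulE out_proj_inner mul1g.
pose k u : {ffun 'I_(size F) -> 'I_(size E).+1} :=
  [ffun i : 'I_(size F) => inord (index (b u (nth 1 F i)) E)].
exists ({ffun 'I_(size F) -> 'I_(size E).+1} * T)%type,
  (fun u => (k u, f (b u))).
move=> u v [/ffunP kuv /fN Nuv].
have [[bu Eu] [bv Ev]] := (bP u, bP v).
exists ((b u)^-1 * b v); split=> //; last by rewrite out_mulE out_mulV bu bv.
move=> x xF; rewrite autM -[RHS](autVf (b u)); congr (_ _).
have ix : (index x F < size F)%N by rewrite index_mem.
have := kuv (Ordinal ix); rewrite !ffunE /= nth_index //.
move/(congr1 val); rewrite /= !inordK ?ltnS ?index_size // => Exy.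
by rewrite -(nth_index 1 (Ev x xF)) -Exy nth_index // Eu.
Qed.

(** An outer class in the image has a unique representative that fixes [F] and
    lies in [N], since two of them differ by an inner automorphism; uniqueness
    makes the choice multiplicative. *)
Lemma virtual_section N :
  is_subgroup N -> fin_index N -> avoids_inner N ->
  exists2 B : groupClosed (Out G), finite_index B &
  exists g : {multiplicative subgroup_type B -> Aut G},
    forall b, [/\ out_proj G (g b) = val b, N (g b) & fixes_family (g b)].
Proof.
move=> sN fN avN.
pose P u := exists a, [/\ fixes_family a, N a & out_proj G a = u].
have [F1 FM FV] := fixes_family_subgroup; have [N1 NM NV] := sN.
have sP : is_subgroup P.
  split; first by exists 1; split=> //; exact: multiplicative1.
    move=> u v [a [Fa Na <-]] [b [Fb Nb <-]].
    by exists (a * b); split; [exact: FM | exact: NM | exact: gmulfM].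
  move=> u [a [Fa Na <-]].
  by exists a^-1; split; [exact: FV | exact: NV | exact: multiplicativeV].
exists (classical_subgroup sP).
  by apply/(fin_index_group sP)/fin_index_out_image.
have gP (b : subgroup_type (classical_subgroup sP)) :
    {a | [/\ out_proj G a = val b, N a & fixes_family a]}.
  apply: cid; case: b => u uP /=; have /classical_subgroupP[a [? ? ?]] := uP.
  by exists a.
pose g b := sval (gP b).
have gE b : [/\ out_proj G (g b) = val b, N (g b) & fixes_family (g b)].
  by rewrite /g; case: (gP b).
have gM : {morph g : x y / x * y}.
  move=> x y; have [ox Nx Fx] := gE x; have [oy Ny Fy] := gE y.
  have [oxy Nxy Fxy] := gE (x * y).
  apply: (mulgI (g (x * y))^-1); rewrite mulVg; apply/esym/avN.
  - by apply/out_projP; rewrite oxy out_mulE ox oy.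
  - exact/FM/FM/Fy/Fx/FV.
  exact/NM/NM/Ny/Nx/NV.
pose gH := isMultiplicative.Build _ _ g gM.
pose g' : {multiplicative subgroup_type (classical_subgroup sP) -> Aut G} :=
  HB.pack g gH.
by exists g'.
Qed.

End VirtualSection.

(** The group [N] is a finite intersection of stabilizers that separate the
    finitely many inner automorphisms by elements of [C] from the identity.
    Every residual property of [Out G] is then obtained by transporting the
    stabilizers [A n] along a section with values in [N], or in the
    intersection of [N] with the groups provided by the primes in question. *)
Theorem virtual_splitting_criterion (G : groupType) (F E C : seq G) :
  finitely_generated G -> has_p_filtrations G -> rigid_family F E C ->
  [/\ splits_virtually (out_proj G),
      forall p : nat, prime p -> virtually (residually_p p) (Out G),
      residually_finite (Out G)
    & virtually torsion_free (Out G)].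
Proof.
move=> fgG filG rigF.
have autF p : prime p -> _ := fun pp =>
  let: ex_intro Fp (And4 filF nF fF capF) := filG p pp in
  aut_virtually_residually_p (prime_gt0 pp) fgG filF nF fF capF.
have [_ [A [_ AP capA _]]] := autF 2 isT.
have [N [sN fN avN]] :
    exists N, [/\ is_subgroup N, fin_index N & avoids_inner F N].
  suff [N [sN fN NC]] : exists N : Aut G -> Prop, [/\ is_subgroup N, fin_index N
      & forall c, c \in C -> N (inner c) -> inner c = 1].
    by exists N; split=> //; exact: (avoids_innerP rigF NC).
  elim: (C) => [|c cs [N [sN fN NC]]].
    by exists (fun=> True); split=> //; exists unit, (fun=> tt).
  have [ic1|nic1] := EM (inner c = 1).
    by exists N; split=> // d; rewrite inE => /predU1P[-> _ //|/NC].
  have [n nA] : exists n, ~ A n (inner c).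
    by apply/existsNP => Ac; apply/nic1/capA.
  have [sA _ fA] := AP n; exists (fun a => N a /\ A n a); split.
  - exact: is_subgroupI.
  - exact: fin_indexI.
  by move=> d; rewrite inE => /predU1P[-> [_ /nA]|/NC Nd [/Nd]].
have avI M : avoids_inner F (fun a => N a /\ M a).
  by move=> a aI Fa [Na _]; apply: avN.
have sec M : is_subgroup M -> fin_index M ->
  exists2 B : groupClosed (Out G), finite_index B &
  exists g : {multiplicative subgroup_type B -> Aut G},
    forall b, [/\ out_proj G (g b) = val b, N (g b) /\ M (g b)
                & fixes_family F (g b)].
  move=> sM fM; apply: (virtual_section rigF (is_subgroupI sN sM)) => //.
  exact: fin_indexI.
have sT : is_subgroup (fun _ : Aut G => True) by [].
have fT : fin_index (fun _ : Aut G => True) by exists unit, (fun=> tt).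
have g_inj (B : groupClosed (Out G))
    (g : {multiplicative subgroup_type B -> Aut G}) :
    (forall b, out_proj G (g b) = val b) -> forall b, g b = 1 -> b = 1.
  by move=> gP b gb1; apply: val_inj; rewrite /= -gP gb1 multiplicative1.
have resid p (pp : prime p) : exists M : Aut G -> Prop,
    [/\ is_subgroup M, fin_index M
    & forall (B : groupClosed (Out G))
             (g : {multiplicative subgroup_type B -> Aut G}),
      (forall b, out_proj G (g b) = val b) -> (forall b, M (g b)) ->
      residually_p p (subgroup_type B)].
  have [M [K [[sM fM] KP capK MK]]] := autF p pp; exists M;
    split=> // B g gP gM.
  apply: residually_p_of_subgroups => // x x1.
  have [n nK] : exists n, ~ K n (g x).
    by apply/existsNP => Kx; apply/x1/(g_inj _ g gP)/capK.
  have [[K1 KM KV] nmK [T [f fK]]] := KP n.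
  exists (fun b => K n (g b)); split=> //.
  - split=> [|u v Ku Kv|u Ku]; first by rewrite multiplicative1.
      by rewrite gmulfM; apply: KM.
    by rewrite multiplicativeV; apply: KV.
  - move=> u v Ku; rewrite conjgE !gmulfM multiplicativeV -conjgE.
    exact: nmK.
  - by exists T, (f \o g) => u v /= /fK; rewrite gmulfM multiplicativeV.
  by move=> y; have [k Ky] := MK (g y) n (gM y); exists k;
    rewrite multiplicativeX.
split.
- have [B fB [g gP]] := sec _ sT fT; exists B => //; exists g => b.
  by have [] := gP b.
- move=> p pp; have [M [sM fM MP]] := resid p pp.
  have [B fB [g gP]] := sec M sM fM; exists B => //.
  by apply: (MP _ g) => b; have [? []] := gP b.
- move=> x xfin; have [B fB [g gP]] := sec _ sT fT.
  pose b : subgroup_type B := Sub x (xfin B fB).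
  have [ob [Nb _] Fb] := gP b.
  suff gb1 : g b = 1 by rewrite -[x]/(val b) -ob gb1 multiplicative1.
  apply: capA => n; have [sA _ fA] := AP n.
  have [B' fB' [g' gP']] := sec _ sA fA.
  have [ob' [Nb' Ab'] Fb'] := gP' (Sub x (xfin B' fB')).
  set a := g' _ in ob' Nb' Ab' Fb'.
  have [_ NM NV] := sN; have [_ FM FV] := fixes_family_subgroup F.
  suff /(congr1 (fun c => a * c)) : a^-1 * g b = 1.
    by rewrite mulVKg mulg1 => ->.
  apply: avN; [|exact/FM/Fb/FV|exact/NM/Nb/NV].
  by apply/out_projP; rewrite ob ob'.
have [M [sM fM MP]] := resid 2 isT; have [M' [sM' fM' MP']] := resid 3 isT.
have [B fB [g gP]] := sec _ (is_subgroupI sM sM') (fin_indexI fM fM').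
exists B => //; apply: (@torsion_free_residually_p _ 2 3) => //.
  by apply: (MP _ g) => b; have [? [? []]] := gP b.
by apply: (MP' _ g) => b; have [? [? []]] := gP b.
Qed.

(** * Reflection representations and the sign of roots *)

Local Close Scope group_scope.
Local Open Scope ring_scope.

Section Chebyshev.
Variables (R : comNzRingType) (q : R).

(** At [q = 2 cos x] these are the quotients [sin (j x) / sin x], the
    Chebyshev polynomials of the second kind with a shifted index. They are the
    coefficients that appear when two simple reflections are alternated. *)
Fixpoint cheb (j : nat) : R :=
  match j with
  | 0 => 0
  | 1 => 1
  | (i.+1 as k).+1 => q * cheb k - cheb i
  end.

Lemma chebSS j : cheb j.+2 = q * cheb j.+1 - cheb j.
Proof. by []. Qed.

End Chebyshev.

(** The features of a Coxeter group on which the theory of roots rests. The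
    matrices [rho] act on columns, that is on linear functionals given by their
    values on the simple roots; the geometric representation is the dual one,
    so that a root is a row vector. The two cases of [cartan_braid] are those
    of a finite and of an infinite bond. *)
Record reflection_rep (R : realFieldType) (G : groupType) (n : nat) :=
  ReflectionRep {
  gen : 'I_n -> G;
  cartan : 'I_n -> 'I_n -> R;
  rho : G -> 'M[R]_n;
  sgn : G -> bool;
  gen_generates : forall P : G -> Prop,
    is_subgroup P -> (forall i, P (gen i)) -> forall x, P x;
  genK : forall i, (gen i * gen i = 1)%g;
  rho1 : rho 1%g = 1%:M;
  rhoM : forall x y, rho (x * y)%g = rho x *m rho y;
  rho_gen : forall i, rho (gen i) = 1%:M - (\col_u cartan i u) *m delta_mx 0 i;
  sgnM : forall x y, sgn (x * y)%g = sgn x (+) sgn y;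
  sgn_gen : forall i, sgn (gen i);
  cartan_diag : forall i, cartan i i = 2;
  cartan_sym : forall i j, cartan i j = cartan j i;
  cartan_braid : forall i j, i != j ->
    (exists2 m, (0 < m)%N & ((gen i * gen j) ^+ m = 1)%g /\
       forall k, (k <= m)%N -> 0 <= cheb (- cartan i j) k)
    \/ forall k, 0 <= cheb (- cartan i j) k
}.

Section RootSigns.
Variables (R : realFieldType) (G : groupType) (n : nat).
Variable V : reflection_rep R G n.
Local Notation r := (gen V).
Local Notation a := (cartan V).
Local Notation rho := (rho V).
Implicit Types (w g : G) (s t : 'I_n).

Lemma genV s : (r s)^-1%g = r s.
Proof. by apply/(@mulgI _ (r s)); rewrite mulgV genK. Qed.

Lemma genKr w s : (w * r s * r s)%g = w.
Proof. by rewrite -mulgA genK mulg1. Qed.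

Definition wprod (w : seq 'I_n) : G := (\prod_(i <- w) r i)%g.

Lemma wprod_cat u v : wprod (u ++ v) = (wprod u * wprod v)%g.
Proof. exact: big_cat. Qed.

Lemma wprod_rev u : wprod (rev u) = (wprod u)^-1%g.
Proof.
elim: u => [|i u IH]; first by rewrite /wprod !big_nil invg1.
by rewrite rev_cons -cats1 wprod_cat IH {2 3}/wprod big_seq1 big_cons
  invgM genV.
Qed.

Lemma wprod_surj g : exists w : seq _, wprod w = g.
Proof.
move: g; apply: (@gen_generates _ _ _ V
  (fun g => exists w : seq _, wprod w = g)) => [|i].
  split; first by exists [::]; rewrite /wprod big_nil.
    by move=> x y [u <-] [v <-]; exists (u ++ v); rewrite wprod_cat.
  by move=> x [u <-]; exists (rev u); rewrite wprod_rev.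
by exists [:: i]; rewrite /wprod big_seq1.
Qed.

Lemma exists_length g :
  exists k, `[< exists2 w : seq _, size w = k & wprod w = g >].
Proof.
by have [w wg] := wprod_surj g; exists (size w); apply/asboolP; exists w.
Qed.

Definition len g : nat := ex_minn (exists_length g).

Lemma lenP g : exists2 w : seq _, size w = len g & wprod w = g.
Proof. by rewrite /len; case: ex_minnP => k /asboolP. Qed.

Lemma len_wprod (w : seq _) : (len (wprod w) <= size w)%N.
Proof.
by rewrite /len; case: ex_minnP => k _; apply; apply/asboolP; exists w.
Qed.

Lemma len_eq0 g : len g = 0%N -> g = 1%g.
Proof. by have [w <- <-] := lenP g => /size0nil ->; rewrite /wprod big_nil. Qed.

Lemma len_gen g s : (len (g * r s)%g <= (len g).+1)%N.
Proof.
have [w <- <-] := lenP g; have := len_wprod (w ++ [:: s]).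
by rewrite wprod_cat size_cat addn1 /wprod big_seq1.
Qed.

Lemma len_gen_ge g s : (len g <= (len (g * r s)%g).+1)%N.
Proof. by have := len_gen (g * r s)%g s; rewrite genKr. Qed.

(** The sign forbids [len (g s) = len g], so multiplication by a generator
    either increases or decreases the length by one. *)
Lemma sgn_len g : sgn V g = odd (len g).
Proof.
have [w <- <-] := lenP g; elim: w => [|i w IH].
  rewrite /wprod big_nil /=; have := sgnM V 1%g 1%g.
  by rewrite mulg1; case: sgn.
by rewrite /wprod big_cons sgnM sgn_gen IH.
Qed.

Lemma len_gen_neq g s : len (g * r s)%g != len g.
Proof.
apply/eqP=> E; have := sgnM V g (r s).
by rewrite !sgn_len E -!sgn_len sgn_gen; case: sgn.
Qed.

Lemma len_gen_lt g s :
  (len g < len (g * r s)%g)%N = ~~ (len (g * r s)%g < len g)%N.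
Proof. by have := len_gen_neq g s; case: ltngtP. Qed.

(** The image under [w] of the simple root [s]: row [s] of [rho w^-1] is the
    functional that evaluates [rho w^-1 y] at the simple root [s]. *)
Definition wroot w s : 'rV[R]_n := row s (rho w^-1%g).

Lemma rho_genE s (X : 'M[R]_n) :
  rho (r s) *m X = X - (\col_u a s u) *m row s X.
Proof. by rewrite rho_gen mulmxBl mul1mx -mulmxA -rowE. Qed.

Lemma root_gen w s t : wroot (w * r t)%g s = wroot w s - a t s *: wroot w t.
Proof.
rewrite /wroot invgM genV rhoM rho_genE; apply/rowP=> j.
by rewrite !mxE big_ord1 !mxE.
Qed.

Lemma root_gen_id w s : wroot (w * r s)%g s = - wroot w s.
Proof.
by rewrite root_gen cartan_diag scaler_nat mulr2n opprD addrA subrr sub0r.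
Qed.

Lemma rhoVK g : rho g^-1%g *m rho g = 1%:M.
Proof. by rewrite -rhoM mulVg rho1. Qed.

Lemma root_neq0 w s : wroot w s != 0.
Proof.
apply/eqP => rt0; have : row s (rho w^-1%g) *m rho w = 0.
  by rewrite -/(wroot w s) rt0 mul0mx.
rewrite -row_mul rhoVK => /rowP/(_ s); rewrite !mxE eqxx => /eqP.
by rewrite oner_eq0.
Qed.

Definition nonneg m (v : 'rV[R]_m) : Prop := forall j, 0 <= v 0 j.

Section Descent.
Variables (w : G) (s t : 'I_n).

Let x j := if odd j then s else t.

Let xSS j : x j.+2 = x j. Proof. by rewrite /x /= negbK. Qed.

Let a_x j : a (x j) (x j.+1) = a s t.
Proof. by rewrite /x /=; case: (odd j) => //=; rewrite cartan_sym. Qed.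

(** Multiplying on the right by [t, s, t, ...], respectively [s, t, s, ...]. *)
Fixpoint descent j := if j is i.+1 then (descent i * r (x i))%g else w.
Fixpoint ascent j := if j is i.+1 then (ascent i * r (x i.+1))%g else w.

(** Alternating [s] and [t] keeps the root in the span of two roots attached to
    the current element, with Chebyshev coefficients. *)
Lemma root_descent j :
  wroot w s = cheb (- a s t) j *: wroot (descent j) (x j)
             + cheb (- a s t) j.+1 *: wroot (descent j) (x j.+1).
Proof.
elim: j => [|j ->]; first by rewrite /= scale0r add0r scale1r.
set D := descent j.+1; have -> : descent j = (D * r (x j))%g by rewrite genKr.
rewrite root_gen_id root_gen a_x chebSS xSS.
set u := wroot D (x j); set v := wroot D (x j.+1).
by apply/rowP=> i; rewrite !mxE; ring.
Qed.

Lemma ascent_descent j :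
  ((ascent j)^-1 * descent j = (r (x j) * r (x j.+1)) ^+ j)%g.
Proof.
elim: j => [|j IH]; first by rewrite /= mulVg.
rewrite /= invgM genV -!mulgA (mulgA _ (descent j)) IH xSS.
case: j {IH} => [|j]; first by rewrite expg0 mul1g expg1.
set u := r (x j.+1); set v := r (x j.+2).
elim: (j.+1) => [|k IH]; first by rewrite expg0 mul1g expg1.
by rewrite expgS -!mulgA [RHS]expgS -IH -!mulgA.
Qed.

(** The braid relation: both alternating products of length [m] agree. *)
Lemma descent_braid m : ((r s * r t) ^+ m = 1)%g -> descent m = ascent m.
Proof.
move=> stm; apply: (mulgI (ascent m)^-1%g); rewrite mulVg ascent_descent /x /=.
case: (odd m) => //=; rewrite -[LHS]invgK -expVgn invgM !genV stm.
by rewrite invg1.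
Qed.

Lemma ascent_len m : (len (w * r s)%g <= len (ascent m.+1) + m)%N.
Proof.
elim: m => [|m IH]; first by rewrite addn0.
by apply: leq_trans IH _; rewrite addnS -addSn leq_add2r; apply: len_gen_ge.
Qed.

End Descent.

(** Induction on the length of [w]. Choose [t] such that [w t] is shorter than
    [w], and multiply by [t, s, t, ...] as long as the length decreases. At the
    element [v] where this stops, neither [s] nor [t] decreases the length, so
    both roots attached to [v] are nonnegative by induction, and the root of
    [w] is a Chebyshev combination of them. The coefficients are nonnegative
    because the descent is shorter than [m]: otherwise the braid relation would
    let the descending product start with [s], which increases the length. *)
Theorem root_nonneg w s : (len w < len (w * r s)%g)%N -> nonneg (wroot w s).
Proof.
have [N] := ubnP (len w); elim: N w s => // N IH w s wN ws.
have [w0|w_gt0] := posnP (len w).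
  by move=> j; rewrite /wroot (len_eq0 w0) invg1 rho1 !mxE ler0n.
have [t wt] : exists t, (len (w * r t)%g < len w)%N.
  have [u us uw] := lenP w; case/lastP: u us uw w_gt0 => [<- //|u t].
  rewrite size_rcons -cats1 wprod_cat {2}/wprod big_seq1 => us uw _.
  by exists t; rewrite -us -{1}uw genKr ltnS len_wprod.
have s_t : s != t.
  by apply/eqP=> st; move: ws; rewrite st len_gen_lt wt.
pose D := descent w s t.
have [k0 kP] : exists k, (len (D k) < len (D k.+1))%N.
  apply: contrapT => noex.
  have Dj j : (len (D j) + j <= len w)%N.
    elim: j => [|j IHj]; first by rewrite addn0.
    apply: leq_trans IHj; rewrite addnS -addSn leq_add2r.
    by apply: contrapT => /negP; rewrite -len_gen_lt => ?; apply: noex;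
      exists j.
  by have := leq_trans (leq_addl _ _) (Dj (len w).+1); rewrite ltnn.
have [k {k0}kP kmin] :=
  ex_minnP (ex_intro (fun k => len (D k) < len (D k.+1))%N k0 kP).
have Dlt j : (j < k)%N -> (len (D j.+1) < len (D j))%N.
  move=> jk; apply: contraLR jk => jk; rewrite -leqNgt; apply: kmin.
  by rewrite len_gen_lt.
have Dj j : (j <= k)%N -> (len (D j) + j <= len w)%N.
  elim: j => [|j IHj] jk; first by rewrite addn0.
  apply: leq_trans (IHj (ltnW jk)); rewrite addnS -addSn leq_add2r.
  exact: Dlt.
case: k kP {kmin} Dlt Dj => [|k] kP Dlt Dj; first by move: kP;
  rewrite len_gen_lt wt.
have DN : (len (D k.+1) < N)%N.
  rewrite -ltnS; apply: leq_ltn_trans wN; apply: leq_trans (Dj _ (leqnn _)).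
  by rewrite addnS ltnS leq_addr.
set x := fun j => if odd j then s else t.
have pos1 : nonneg (wroot (D k.+1) (x k.+1)) by apply: IH.
have pos2 : nonneg (wroot (D k.+1) (x k.+2)).
  apply: IH => //; have -> : x k.+2 = x k by rewrite /x /= negbK.
  by rewrite [X in (X * _)%g]/(D k * r (x k))%g genKr Dlt.
have kcheb : 0 <= cheb (- a s t) k.+1 /\ 0 <= cheb (- a s t) k.+2.
  have [[m m_gt0 [stm chebm]]|] := cartan_braid V s_t; last by [].
  suff km : (k.+1 < m)%N by split; apply: chebm => //; apply: ltnW.
  rewrite ltnNge; apply/negP => mk; have := Dj m mk.
  rewrite /D (descent_braid w stm) -(prednK m_gt0) addnS.
  have := ascent_len w s t m.-1.
  by move=> A B; move: (leq_trans A (ltnW B)); rewrite leqNgt ws.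
case: kcheb => c1 c2 j; rewrite (root_descent w s t k.+1).
rewrite mxE [X in X + _]mxE [X in _ + X]mxE.
by apply: addr_ge0; apply: mulr_ge0; [| exact: pos1 | | exact: pos2].
Qed.

End RootSigns.

(** * The dominant chamber and finite subgroups *)

Section DominantChamber.
Variables (R : realFieldType) (G : groupType) (n : nat).
Variable V : reflection_rep R G n.
Local Notation r := (gen V).
Local Notation a := (cartan V).
Local Notation rho := (rho V).
Implicit Types (w g u : G) (s t : 'I_n) (v : 'rV[R]_n) (y z : 'cV[R]_n).

Lemma root_sign w s : nonneg (wroot V w s) \/ nonneg (- wroot V w s).
Proof.
have [lt|] := boolP (len V w < len V (w * r s)%g)%N; first by left;
  apply: root_nonneg.
rewrite len_gen_lt negbK => gt; right; rewrite -root_gen_id.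
by apply: root_nonneg; rewrite genKr.
Qed.

(** The last letter of a shortest word for [w] gives a negative root. *)
Lemma nonneg_root1 w : (forall s, nonneg (wroot V w s)) -> w = 1%g.
Proof.
move=> pos; apply: (len_eq0 (V := V)); apply: contrapT => /eqP;
  rewrite -lt0n => w_gt0.
have [u us uw] := lenP V w; case/lastP: u us uw => [us|u t us uw].
  by rewrite -us in w_gt0.
have wt : (len V (w * r t)%g < len V w)%N.
  rewrite -us -{1}uw -cats1 wprod_cat {2}/wprod big_seq1 genKr size_cat addn1.
  by rewrite ltnS len_wprod.
have neg : nonneg (- wroot V w t).
  by rewrite -root_gen_id; apply: root_nonneg; rewrite genKr.
have /eqP[] := root_neq0 V w t; apply/rowP=> j; apply/eqP.
by rewrite [X in _ == X]mxE eq_le pos andbT -oppr_ge0; have := neg j;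
  rewrite mxE.
Qed.

Definition is_root v : Prop := exists w s, v = wroot V w s.

(** Roots are compared up to positive multiples, which avoids the invariant
    bilinear form that would normalize them. *)
Definition ray v v' : Prop := exists2 c : R, 0 < c & v = c *: v'.

Definition ev v y : R := (v *m y) 0 0.

Lemma evE v y : ev v y = \sum_j v 0 j * y j 0.
Proof. by rewrite /ev mxE. Qed.

Lemma ev_rho v g y : ev v (rho g *m y) = ev (v *m rho g) y.
Proof. by rewrite /ev mulmxA. Qed.

Lemma evZ c v y : ev (c *: v) y = c * ev v y.
Proof. by rewrite /ev -scalemxAl mxE. Qed.

Lemma evN v y : ev (- v) y = - ev v y.
Proof. by rewrite /ev mulNmx mxE. Qed.

Lemma ev_ge0 v y : nonneg v -> (forall s, 0 <= y s 0) -> 0 <= ev v y.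
Proof. by move=> v0 y0; rewrite evE sumr_ge0 // => j _; rewrite mulr_ge0. Qed.

Lemma is_root_rho v g : is_root v -> is_root (v *m rho g).
Proof.
by case=> w [s ->]; exists (g^-1 * w)%g, s;
  rewrite /wroot -row_mul -rhoM invgM invgK.
Qed.

Lemma is_root_neq0 v : is_root v -> v != 0.
Proof. by case=> w [s ->]; apply: root_neq0. Qed.

Lemma is_root_sign v : is_root v -> nonneg v \/ nonneg (- v).
Proof. by case=> w [s ->]; apply: root_sign. Qed.

Lemma root_simple s : wroot V 1%g s = delta_mx 0 s.
Proof. by rewrite /wroot invg1 rho1 row1. Qed.

Lemma ev_simple s y : ev (delta_mx 0 s) y = y s 0.
Proof. by rewrite /ev -rowE mxE. Qed.

Lemma simple_root s : is_root (delta_mx 0 s).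
Proof. by exists 1%g, s; rewrite root_simple. Qed.

Lemma mul_rho_gen v s j : j != s -> (v *m rho (r s)) 0 j = v 0 j.
Proof.
move=> js; rewrite rho_gen mulmxBr mulmx1 mulmxA mxE mxE [X in _ - X]mxE.
by rewrite big_ord1 [delta_mx _ _ _ _]mxE (negbTE js) andbF mulr0 subr0.
Qed.

Lemma rho_genK s : rho (r s) *m rho (r s) = 1%:M.
Proof. by rewrite -rhoM genK rho1. Qed.

(** A simple reflection changes a single coordinate of a root, so a positive
    root that it makes negative is supported on that coordinate. *)
Lemma nonneg_reflect v s : is_root v -> nonneg v -> ~ ray v (delta_mx 0 s) ->
  nonneg (v *m rho (r s)).
Proof.
move=> rv v0 vs; have [//|neg] := is_root_sign (is_root_rho (r s) rv).
have vj j : j != s -> v 0 j = 0.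
  move=> js; apply/eqP; rewrite eq_le v0 andbT -oppr_ge0.
  by have := neg j; rewrite mxE mul_rho_gen.
have vE : v = v 0 s *: delta_mx 0 s.
  apply/rowP=> j; rewrite !mxE eqxx /=; case: eqVneq => [->|/vj ->].
    by rewrite mulr1.
  by rewrite mulr0.
case: vs; exists (v 0 s) => //; rewrite lt_def v0 andbT.
by apply: contraNneq (is_root_neq0 rv) => vs0; rewrite vE vs0 scale0r.
Qed.

Definition nonpos_cover (B : seq 'rV[R]_n) y : Prop :=
  forall v, is_root v -> nonneg v -> ev v y <= 0 ->
    exists2 b, b \in B & ray v b.

(** Existence of such a [k] says that [y] lies in the interior of the Tits
    cone. *)
Definition nonpos_bound k y : Prop :=
  exists2 B, (size B <= k)%N & nonpos_cover B y.

Lemma ray_reflect v b s : ray (v *m rho (r s)) b -> ray v (b *m rho (r s)).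
Proof.
by case=> c c0 vb; exists c => //;
  rewrite scalemxAl -vb -mulmxA rho_genK mulmx1.
Qed.

Lemma nonpos_bound_up k y s :
  nonpos_bound k y -> nonpos_bound k.+1 (rho (r s) *m y).
Proof.
case=> B Bk BP; exists (delta_mx 0 s :: [seq b *m rho (r s) | b <- B]).
  by rewrite /= size_map.
move=> v rv v0; rewrite ev_rho => vy.
have [vs|/(nonneg_reflect rv v0) v0'] := EM (ray v (delta_mx 0 s)).
  by exists (delta_mx 0 s); rewrite ?mem_head.
have [b bB vb] := BP _ (is_root_rho (r s) rv) v0' vy.
exists (b *m rho (r s)); first by rewrite inE (map_f (fun b => b *m _)) ?orbT.
exact: ray_reflect.
Qed.

(** The reflection permutes the positive roots other than the simple root [s],
    and makes [y] positive on [s]. *)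
Lemma nonpos_bound_down k y s : nonpos_bound k y -> y s 0 < 0 ->
  exists2 l, k = l.+1 & nonpos_bound l (rho (r s) *m y).
Proof.
case=> B Bk BP ys.
have delta0 : nonneg (delta_mx 0 s : 'rV[R]_n) by move=> j; rewrite mxE ler0n.
have [|b bB [c c0 bE]] := BP _ (simple_root s) delta0.
  by rewrite ev_simple ltW.
have B_gt0 : (0 < size B)%N by case: (B) bB.
case: k Bk => [|l Bl]; first by rewrite leqNgt B_gt0.
exists l => //; exists [seq b *m rho (r s) | b <- rem b B].
  by rewrite size_map size_rem // -ltnS prednK.
move=> v rv v0; rewrite ev_rho => vy.
have delta_refl : (delta_mx 0 s : 'rV[R]_n) *m rho (r s) = - delta_mx 0 s.
  have := root_gen_id V 1%g s; rewrite root_simple => <-.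
  by rewrite mul1g /wroot genV rowE.
have vs : ~ ray v (delta_mx 0 s).
  case=> d d0 vE; move: vy; rewrite vE -scalemxAl evZ delta_refl evN ev_simple.
  by rewrite leNgt mulr_gt0 ?oppr_gt0.
have v0' := nonneg_reflect rv v0 vs.
have [b' b'B vb'] := BP _ (is_root_rho (r s) rv) v0' vy.
exists (b' *m rho (r s)); last exact: ray_reflect.
apply: (map_f (fun b => b *m _)); move: b'B;
  rewrite (perm_mem (perm_to_rem bB)) inE => /predU1P[b'E|//].
have bE' : b = c^-1 *: delta_mx 0 s.
  by rewrite bE scalerA mulVf ?gt_eqF // scale1r.
have [d d0 vE] := ray_reflect vb'; have := v0 s.
rewrite vE b'E bE' -scalemxAl delta_refl !mxE !eqxx leNgt.
by rewrite mulrN mulrN oppr_lt0 mulr1 mulr_gt0 ?invr_gt0.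
Qed.

Lemma nonpos_bound_rho k y g :
  nonpos_bound k y -> nonpos_bound (k + len V g) (rho g *m y).
Proof.
move=> ky; have [w <- <-] := lenP V g.
elim: w => [|s w IH]; first by rewrite /wprod big_nil rho1 mul1mx addn0.
by rewrite /wprod big_cons rhoM -mulmxA addnS; apply: nonpos_bound_up.
Qed.

Lemma nonpos_boundD k l y z :
  nonpos_bound k y -> nonpos_bound l z -> nonpos_bound (k + l) (y + z).
Proof.
move=> [B Bk BP] [C Cl CP]; exists (B ++ C); first by rewrite size_cat leq_add.
move=> v rv v0; rewrite /ev mulmxDr mxE => yz.
have [vy|vy] := leP (ev v y) 0.
  by have [b bB vb] := BP v rv v0 vy; exists b => //; rewrite mem_cat bB.
have [|b bC vb] := CP v rv v0; last by exists b; rewrite // mem_cat bC orbT.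
by apply: le_trans yz; rewrite lerDr ltW.
Qed.

Lemma nonpos_bound_sum (I : Type) (i : I) (s : seq I) (y : I -> 'cV[R]_n) :
  (forall i, exists k, nonpos_bound k (y i)) ->
  exists k, nonpos_bound k (\sum_(j <- i :: s) y j).
Proof.
move=> yP; elim: s i => [|j s IH] i; first by rewrite big_seq1.
have [[k ik] [l jl]] := (yP i, IH j); exists (k + l)%N.
by rewrite big_cons; apply: nonpos_boundD.
Qed.

Definition ones : 'cV[R]_n := const_mx 1.

Lemma ev_ones_gt0 v : is_root v -> nonneg v -> 0 < ev v ones.
Proof.
move=> rv v0; rewrite lt_def ev_ge0 ?andbT => [|//|s];
  last by rewrite mxE ler01.
apply: contra_neq (is_root_neq0 rv) => /eqP.
rewrite evE psumr_eq0 => [/allP ev0|j _].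
  apply/rowP=> j; have := ev0 j (mem_index_enum j).
  by rewrite !mxE mulr1 => /eqP.
by rewrite mxE mulr1.
Qed.

Lemma nonpos_bound_ones : nonpos_bound 0 ones.
Proof.
by exists [::] => // v rv v0; rewrite leNgt ev_ones_gt0.
Qed.

Lemma dominant_word k y : nonpos_bound k y ->
  exists2 w : seq 'I_n, (size w <= k)%N &
    forall s, 0 <= (rho (wprod V w) *m y) s 0.
Proof.
elim: k y => [|k IH] y ky;
  have [ys|/existsNP[s /negP]] := EM (forall s, 0 <= y s 0);
  try by exists [::] => // s; rewrite /wprod big_nil rho1 mul1mx.
  by rewrite -ltNge => /(nonpos_bound_down ky)[].
rewrite -ltNge => /(nonpos_bound_down ky)[_ [<-] /IH[w wk wy]].
exists (w ++ [:: s]) => [|t]; first by rewrite size_cat addn1.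
by rewrite wprod_cat {2}/wprod big_seq1 rhoM -mulmxA.
Qed.

(** A positive root that [g] makes negative is nonpositive at [y], so there are
    at most [k] inversions of [g]. The inversions of [g] are also the positive
    roots that are negative at [g^-1 ones], hence a word of length at most [k]
    takes [g^-1 ones] to the dominant chamber; as the stabilizer of that
    chamber is trivial, the word represents [g]. *)
Lemma dominant_length k y g : nonpos_bound k y ->
  (forall s, 0 <= (rho g *m y) s 0) -> (len V g <= k)%N.
Proof.
move=> [B Bk BP] gy.
have /dominant_word[w wk wg] : nonpos_bound k (rho g^-1%g *m ones).
  exists B => // v rv v0; rewrite ev_rho; have rv' := is_root_rho g^-1%g rv.
  have [v0'|v0' _] := is_root_sign rv'.
    by rewrite leNgt ev_ones_gt0.
  apply: BP => //; rewrite -[v]mulmx1 -(rhoVK V g) mulmxA -ev_rho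
    -oppr_ge0 -evN.
  exact: ev_ge0.
set h := (wprod V w * g^-1)%g.
suff h1 : h^-1%g = 1%g.
  move: h1; rewrite invgM invgK => /divg1_eq ->;
    exact: leq_trans (len_wprod V w) wk.
apply: nonneg_root1 => s; have [//|neg] := root_sign h^-1%g s.
have rneg : is_root (- wroot V h^-1%g s).
  by rewrite -root_gen_id; exists (h^-1 * r s)%g, s.
have := ev_ones_gt0 rneg neg; rewrite evN oppr_gt0 ltNge.
rewrite /ev /wroot invgK -row_mul [row _ _ _ _]mxE rhoM -mulmxA.
by rewrite wg.
Qed.

(** A point in the relative interior of the face of the dominant chamber on
    which exactly the simple roots in [I] vanish. *)
Definition face (I : {set 'I_n}) : 'cV[R]_n := \col_j (j \notin I)%:R.

Definition zero_set y : {set 'I_n} := [set s | y s 0 == 0].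

Lemma face_ge0 I s : 0 <= face I s 0.
Proof. by rewrite mxE ler0n. Qed.

Lemma zero_set_face I : zero_set (face I) = I.
Proof. by apply/setP=> s; rewrite inE mxE pnatr_eq0 eqb0 negbK. Qed.

Lemma ev_le0_support v y j : nonneg v -> (forall s, 0 <= y s 0) ->
  ev v y <= 0 -> j \notin zero_set y -> v 0 j = 0.
Proof.
move=> v0 y0 vy; rewrite inE => yj; apply/eqP.
have := vy; rewrite le_eqVlt ltNge ev_ge0 // orbF evE psumr_eq0 => [|i _].
  by move/allP=> /(_ j (mem_index_enum j));
    rewrite /= mulf_eq0 (negbTE yj) orbF.
by rewrite mulr_ge0.
Qed.

(** For dominant [z] a positive root is nonpositive at [z] only if it is
    supported on the simple roots where [z] vanishes. Hence the bound of a
    dominant functional depends only on its zero set, which leaves finitely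
    many bounds in all. *)
Lemma nonpos_bound_support k y z :
  (forall s, 0 <= z s 0) -> (forall s, s \in zero_set z -> y s 0 <= 0) ->
  nonpos_bound k y -> nonpos_bound k z.
Proof.
move=> z0 zy [B Bk BP]; exists B => // v rv v0 vz; apply: BP => //.
rewrite evE sumr_le0 // => j _; have [jz|jz] := boolP (j \in zero_set z).
  by rewrite mulr_ge0_le0 ?zy.
by rewrite (ev_le0_support v0 z0 vz jz) mul0r.
Qed.

(** Equivalent to the finiteness of the parabolic subgroup generated by [I]. *)
Definition spherical (I : {set 'I_n}) : Prop :=
  exists k, nonpos_bound k (face I).

Definition face_bound (I : {set 'I_n}) : nat :=
  if pselect (spherical I) is left e then sval (cid e) else 0.

Lemma face_boundP I : spherical I -> nonpos_bound (face_bound I) (face I).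
Proof. by rewrite /face_bound; case: pselect => // e _; case: cid. Qed.

Definition max_bound : nat := \max_(I : {set 'I_n}) face_bound I.

Definition short_elements : seq G :=
  flatten [seq [seq wprod V w | w : k.-tuple 'I_n] | k <- iota 0 max_bound.+1].

Lemma mem_short_elements g : (len V g <= max_bound)%N -> g \in short_elements.
Proof.
have [w <- <-] := lenP V g => wM; apply/flatten_mapP; exists (size w).
  by rewrite mem_iota add0n ltnS.
by apply/imageP; exists (in_tuple w).
Qed.

Lemma spherical_short I g : spherical I ->
  (forall s, 0 <= (rho g *m face I) s 0) -> g \in short_elements.
Proof.
move=> /face_boundP Ik gI; apply/mem_short_elements.
by apply: leq_trans (dominant_length Ik gI) _; apply: (leq_bigmax I).
Qed.

Lemma dominant_stab_short y k g : nonpos_bound k y -> (forall s, 0 <= y s 0) ->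
  rho g *m y = y -> g \in short_elements.
Proof.
move=> ky y0 gy; set I := zero_set y.
have sphI : spherical I.
  exists k; apply: nonpos_bound_support (face_ge0 I) _ ky => s.
  by rewrite zero_set_face inE => /eqP ->.
have Iy : nonpos_bound (face_bound I) y.
  apply: nonpos_bound_support y0 _ (face_boundP sphI) => s sI.
  by rewrite mxE sI.
apply/mem_short_elements/(leq_trans (dominant_length Iy _)); last first.
  exact: (leq_bigmax I).
by rewrite gy.
Qed.

(** The sum of the orbit of [ones] under [X] is fixed by [X] and lies in the
    interior of the Tits cone; move it into the dominant chamber. *)
Lemma finite_subgroup_conj (X : seq G) : uniq X -> X != [::] ->
  {in X &, forall g h, (g * h)%g \in X} ->
  exists w, {in X, forall h, (w * h * w^-1)%g \in short_elements}.
Proof.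
case: X => // x X uX _ XM.
have [|k] := @nonpos_bound_sum _ x X (fun g => rho g *m ones).
  by move=> g; eexists; apply/nonpos_bound_rho/nonpos_bound_ones.
set y := \sum_(_ <- _) _ => ky.
have Xy h : h \in x :: X -> rho h *m y = y.
  move=> hX; rewrite /y mulmx_sumr.
  rewrite [RHS](perm_big [seq (h * g)%g | g <- x :: X]).
    by rewrite big_map; apply: eq_bigr => g _; rewrite rhoM mulmxA.
  have uh : uniq [seq (h * g)%g | g <- x :: X].
    by rewrite map_inj_uniq //; apply: mulgI.
  rewrite perm_sym; apply: uniq_perm => //.
  apply: (uniq_min_size uh _ _).2; last by rewrite size_map.
  by move=> _ /mapP[g gX ->]; apply: XM.
have [w wk wy] := dominant_word ky.
exists (wprod V w) => h hX.
apply: dominant_stab_short (nonpos_bound_rho (wprod V w) ky) wy _.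
by rewrite mulmxA -rhoM mulgVK rhoM -mulmxA Xy.
Qed.

Lemma spherical0 : spherical set0.
Proof.
exists 0%N; rewrite (_ : face set0 = ones); first exact: nonpos_bound_ones.
by apply/colP=> j; rewrite !mxE in_set0.
Qed.

Lemma face_gen_fix (I : {set _}) s : s \in I -> rho (r s) *m face I = face I.
Proof.
move=> sI; rewrite rho_gen mulmxBl mul1mx -mulmxA -rowE.
suff -> : row s (face I) = 0 by rewrite mulmx0 subr0.
by apply/rowP=> j; rewrite !mxE sI.
Qed.

(** Take for [F] the stabilizer of the face of a maximal spherical set [I]. If
    [g] centralizes [F], then [z = rho g (face I)] is fixed by the reflections
    in [I], so it vanishes on [I]. It is positive at every other simple root
    [s]: otherwise [z] would be nonpositive on all simple roots in
    [s |: I], and the bound of [z] would make that larger set spherical. So [z]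
    is dominant, which bounds the length of [g]. *)
Theorem coxeter_rigid_family : exists F E C : seq G, rigid_family F E C.
Proof.
have [I] := @arg_maxnP _ set0 (fun I => `[< spherical I >]) (fun I => #|I|)
  (asboolT spherical0).
move=> /asboolP sphI maxI.
pose F := [seq g <- undup short_elements | rho g *m face I == face I].
have memF g : (g \in F) = (rho g *m face I == face I).
  rewrite mem_filter mem_undup; apply: andb_idr => /eqP gI.
  by apply: spherical_short sphI _ => s; rewrite gI face_ge0.
have [FM F1] : {in F &, forall g h, (g * h)%g \in F} /\ 1%g \in F.
  split=> [g h|]; rewrite !memF ?rho1 ?mul1mx //.
  by move=> /eqP gI /eqP hI; rewrite rhoM -mulmxA hI gI.
exists F, short_elements, short_elements; split=> [g gF|b]; last first.
  have [||_ _ /mapP[g gF ->] /mapP[h hF ->]|w wP] :=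
      @finite_subgroup_conj [seq b f | f <- F].
  - by rewrite map_inj_uniq ?filter_uniq ?undup_uniq //; apply/bij_inj/aut_bij.
  - by case: (F) F1.
  - by rewrite -aut_morph map_f // FM.
  by exists w => f fF; apply: wP; rewrite map_f.
set z := rho g *m face I; have zk := nonpos_bound_rho g (face_boundP sphI).
have zI s : s \in I -> z s 0 = 0.
  move=> sI; have sF : r s \in F by rewrite memF face_gen_fix.
  have : rho (r s) *m z = z.
    by rewrite mulmxA -rhoM -gF // rhoM -mulmxA face_gen_fix.
  rewrite rho_gen mulmxBl mul1mx -mulmxA -rowE => /colP/(_ s).
  rewrite mxE [X in _ + X]mxE [(_ *m row s z) _ _]mxE big_ord1 [row s z _ _]mxE.
  by rewrite [(\col_u _) _ _]mxE cartan_diag; lra.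
apply: (spherical_short sphI) => s; rewrite -/z.
have [sI|sI] := boolP (s \in I); first by rewrite zI.
rewrite leNgt; apply/negP => zs.
have : (#|s |: I| <= #|I|)%N.
  apply/maxI/asboolP; eexists;
    apply: nonpos_bound_support (face_ge0 _) _ zk => t.
  by rewrite zero_set_face => /setU1P[->|/zI -> //]; apply: ltW.
by rewrite cardsU1 sI ltnn.
Qed.

End DominantChamber.

(** * Recurrences driven by a cosine *)

Section Trigonometry.
Variable R : realType.
Implicit Types (x : R) (z : nat -> R).

Lemma sinSS x j : sin (x *+ j.+2) = 2 * cos x * sin (x *+ j.+1) - sin (x *+ j).
Proof.
have -> : x *+ j.+2 = x *+ j.+1 + x by rewrite mulrSr.
have -> : x *+ j = x *+ j.+1 - x by rewrite mulrSr addrK.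
by rewrite sinD sinB; ring.
Qed.

Lemma cosSS x j : cos (x *+ j.+2) = 2 * cos x * cos (x *+ j.+1) - cos (x *+ j).
Proof.
have -> : x *+ j.+2 = x *+ j.+1 + x by rewrite mulrSr.
have -> : x *+ j = x *+ j.+1 - x by rewrite mulrSr addrK.
by rewrite cosD cosB; ring.
Qed.

Lemma cheb_sin x j : cheb (2 * cos x) j * sin x = sin (x *+ j).
Proof.
suff [] : cheb (2 * cos x) j * sin x = sin (x *+ j) /\
          cheb (2 * cos x) j.+1 * sin x = sin (x *+ j.+1) by [].
elim: j => [|j [IH IH1]]; first by rewrite /= mul0r mul1r mulr0n sin0 mulr1n.
by split=> //; rewrite chebSS sinSS -IH1 -IH; ring.
Qed.

Lemma piDn_itv (k : nat) : (1 < k)%N -> 0 < (pi / k%:R : R) < pi.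
Proof.
move=> k1; rewrite divr_gt0 ?pi_gt0 ?ltr0n ?(ltnW k1) //=.
by rewrite ltr_pdivrMr ?ltr0n ?(ltnW k1) // ltr_pMr ?pi_gt0 // ltr1n.
Qed.

Lemma cheb_ge0 (k j : nat) : (1 < k)%N -> (j <= k)%N ->
  0 <= cheb (2 * cos (pi / k%:R : R)) j.
Proof.
move=> k1 jk; have sin_gt0 := sin_gt0_pi (piDn_itv k1).
rewrite -(pmulr_lge0 _ sin_gt0) cheb_sin; apply: sin_ge0_pi.
have k0 : (0 : R) < k%:R by rewrite ltr0n (ltnW k1).
apply/andP; split; first by rewrite mulrn_wge0 ?divr_ge0 ?pi_ge0 ?ler0n.
by rewrite -[leLHS]mulr_natr -mulrA ler_piMr ?pi_ge0 // mulrC ler_pdivrMr //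
  mul1r ler_nat.
Qed.

Lemma cheb2_ge0 j : 0 <= cheb (2 : R) j.
Proof.
suff [-> _] : cheb (2 : R) j = j%:R /\ cheb (2 : R) j.+1 = j.+1%:R.
  by rewrite ler0n.
by elim: j => [//|j [IH IH1]]; split=> //;
  rewrite chebSS IH IH1 -[j.+2]addn2 -addn1 !natrD; ring.
Qed.

Lemma periodic_recurrence (k : nat) z (x := pi / k%:R) : (1 < k)%N ->
  (forall i, z i.+2 = 2 * cos x * z i.+1 - z i) ->
  forall i, z (i + k.*2)%N = z i.
Proof.
move=> k1 zSS.
have s0 : sin x != 0 by rewrite gt_eqF // sin_gt0_pi // piDn_itv.
pose b := (z 1%N - z 0%N * cos x) / sin x.
have zE i : z i = z 0%N * cos (x *+ i) + b * sin (x *+ i).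
  suff [] : z i = z 0%N * cos (x *+ i) + b * sin (x *+ i) /\
            z i.+1 = z 0%N * cos (x *+ i.+1) + b * sin (x *+ i.+1) by [].
  elim: i => [|i [IH IH1]]; last by split=> //;
    rewrite zSS IH IH1 cosSS sinSS; ring.
  rewrite !mulr0n !mulr1n cos0 sin0 /b; split; first by ring.
  by field.
have xk : x *+ k.*2 = pi *+ 2.
  rewrite -muln2 mulrnA -[x *+ k]mulr_natr divfK //.
  by rewrite pnatr_eq0 -lt0n ltnW.
by move=> i; rewrite zE [RHS]zE mulrnDr xk cosD2pi sinD2pi.
Qed.

(** Over a full period the even and the odd sums [S] and [T] satisfy
    [2 S = 2 cos x T] and [2 T = 2 cos x S], and [cos x ^+ 2 != 1]. *)
Lemma sum_recurrence_eq0 (k : nat) z (x := pi / k%:R) : (1 < k)%N ->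
  (forall i, z i.+2 = 2 * cos x * z i.+1 - z i) ->
  \sum_(j < k) z j.*2 = 0 /\ \sum_(j < k) z j.*2.+1 = 0.
Proof.
move=> k1 zSS; have per := periodic_recurrence k1 zSS.
have tele (f : nat -> R) :
    f k = f 0%N -> \sum_(j < k) f j.+1 = \sum_(j < k) f j.
  move=> fk; apply: (addrI (f 0%N)).
  have <- : \sum_(j < k.+1) f j = f 0%N + \sum_(j < k) f j.+1.
    by rewrite big_ord_recl.
  by rewrite big_ord_recr /= fk addrC.
set S := \sum_(j < k) z j.*2; set T := \sum_(j < k) z j.*2.+1.
have S1 : \sum_(j < k) z (j.+1).*2 = S.
  by apply: (tele (fun j => z j.*2)); rewrite -(per 0%N).
have T1 : \sum_(j < k) z (j.+1).*2.+1 = T.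
  by apply: (tele (fun j => z j.*2.+1)); rewrite -(per 1%N) addnC addn1.
have E1 : S + S = 2 * cos x * T.
  rewrite -{1}S1 -big_split mulr_sumr.
  by apply: eq_bigr => j _; rewrite doubleS zSS /= subrK.
have E2 : T + T = 2 * cos x * S.
  rewrite -{1}T1 -S1 -big_split mulr_sumr.
  by apply: eq_bigr => j _; rewrite doubleS zSS /= subrK.
have s0 : sin x ^+ 2 != 0.
  by rewrite expf_neq0 // gt_eqF // sin_gt0_pi // piDn_itv.
have TE : T = cos x * S by lra.
have SE : S = cos x ^+ 2 * S by rewrite expr2 -mulrA -TE; lra.
have S0 : S = 0.
  by apply: (mulfI s0); rewrite mulr0 sin2cos2 mulrBl mul1r -SE subrr.
by split=> //; rewrite TE S0 mulr0.
Qed.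

End Trigonometry.

(** * The geometric representation of a Coxeter group *)

Section Words.
Variables (S : Type) (G : groupType) (iota : S -> G).
Implicit Types (w v : word S) (s t : S).

Lemma eval_word_cons l w :
  eval_word iota (l :: w) =
  ((if l.2 then (iota l.1)^-1 else iota l.1) * eval_word iota w)%g.
Proof. by rewrite /eval_word big_cons. Qed.

Lemma eval_word_cat v w :
  eval_word iota (v ++ w) = (eval_word iota v * eval_word iota w)%g.
Proof. exact: big_cat. Qed.

Definition inv_word w : word S := rev [seq (l.1, ~~ l.2) | l <- w].

Lemma eval_inv_word w : eval_word iota (inv_word w) = (eval_word iota w)^-1%g.
Proof.
elim: w => [|[s b] w IH]; first by rewrite /eval_word !big_nil invg1.
rewrite /inv_word /= rev_cons -cats1 eval_word_cat IH [in RHS]eval_word_cons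
  invgM /=.
by rewrite /eval_word big_seq1 /=; case: b; rewrite /= ?invgK.
Qed.

Lemma eval_word_relator (k : nat) s t :
  eval_word iota (flatten (nseq k [:: (s, false); (t, false)])) =
  ((iota s * iota t) ^+ k)%g.
Proof.
elim: k => [|k IH]; first by rewrite /eval_word big_nil.
by rewrite expgS -IH /= !eval_word_cons mulgA.
Qed.

End Words.

Section PresentedAction.
Variables (S : Type) (G : groupType) (iota : S -> G) (rel : word S -> Prop).
Hypothesis presG : is_presented_by iota rel.
Variables (X : Type) (act : S -> X -> X).
Hypothesis actK : forall s, involutive (act s).

(** Inverse letters act like the letters, since the generators act by
    involutions. *)
Definition word_act (w : word S) (x : X) : X := foldr (fun l => act l.1) x w.

Hypothesis act_rel : forall w, rel w -> word_act w =1 id.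

Lemma word_act_cat v w x : word_act (v ++ w) x = word_act v (word_act w x).
Proof. exact: foldr_cat. Qed.

Lemma word_act_eq v w : word_eq rel v w -> word_act v =1 word_act w.
Proof.
elim=> {v w} //.
- by move=> v w _ IH x; rewrite IH.
- by move=> u v w _ IH _ IH' x; rewrite IH.
- by move=> v v' w w' _ IH _ IH' x; rewrite !word_act_cat IH IH'.
- by move=> s b x; rewrite /= actK.
Qed.

Lemma word_act_inv w x : word_act (inv_word w) (word_act w x) = x.
Proof.
elim: w x => [//|[s b] w IH] x.
by rewrite /inv_word /= rev_cons -cats1 word_act_cat /= actK IH.
Qed.

Lemma word_act_eval v w :
  eval_word iota v = eval_word iota w -> word_act v =1 word_act w.
Proof.
move=> vw x; have [_ pres] := presG.
have /pres/word_act_eq vwx : eval_word iota (v ++ inv_word w) = 1%g.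
  by rewrite eval_word_cat eval_inv_word vw mulgV.
by rewrite -[RHS]vwx word_act_cat word_act_inv.
Qed.

Definition group_act (g : G) : X -> X := word_act (sval (cid (presG.1 g))).

Lemma group_act_eval w : group_act (eval_word iota w) =1 word_act w.
Proof. by rewrite /group_act; case: cid => v /= /word_act_eval. Qed.

Lemma group_act1 : group_act 1%g =1 id.
Proof.
by move=> x; have := group_act_eval [::] x; rewrite /eval_word big_nil.
Qed.

Lemma group_actM g h x : group_act (g * h)%g x = group_act g (group_act h x).
Proof.
have [v <-] := presG.1 g; have [w <-] := presG.1 h.
by rewrite -eval_word_cat !group_act_eval word_act_cat.
Qed.

Lemma group_act_gen s : group_act (iota s) =1 act s.
Proof.
move=> x; have := group_act_eval [:: (s, false)] x.
by rewrite /eval_word big_seq1.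
Qed.

Lemma group_act_ind (P : (X -> X) -> Prop) :
  P id -> (forall s f, P f -> P (act s \o f)) -> forall g, P (group_act g).
Proof.
move=> P1 PS g; rewrite /group_act; case: cid => w /= _ {g}.
by elim: w => [//|[s b] w IH]; apply: (PS s).
Qed.

End PresentedAction.

Lemma word_act_relator (S X : Type) (act : S -> X -> X) k s t x :
  word_act act (flatten (nseq k [:: (s, false); (t, false)])) x =
  iter k (act s \o act t) x.
Proof. by elim: k => [//|k IH]; rewrite /= -IH. Qed.

Section GeometricRepresentation.
Variables (R : realType) (S : Type) (m : S -> S -> option nat).
Variables (G : groupType) (iota : S -> G).
Hypothesis coxm : is_coxeter_matrix m.
Hypothesis presG : is_presented_by iota (coxeter_relator m).
Implicit Types (s t u : S) (y : S -> R).

Definition cosine_matrix s t : R :=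
  if m s t is Some k then - (2 * cos (pi / k%:R)) else - 2.

Lemma cosine_matrix_diag s : cosine_matrix s s = 2.
Proof.
have [m1 _ _] := coxm.
by rewrite /cosine_matrix m1 invr1 mulr1 cospi mulrN1 opprK.
Qed.

Lemma cosine_matrix_sym s t : cosine_matrix s t = cosine_matrix t s.
Proof. by have [_ msym _] := coxm; rewrite /cosine_matrix msym. Qed.

(** Functionals are arbitrary functions on the set [S] of simple roots, so that
    the action is available before [S] is known to be finite; it serves to
    prove just that. *)
Definition dual_reflection s y : S -> R :=
  fun t => y t - cosine_matrix s t * y s.

Lemma dual_reflectionK s : involutive (dual_reflection s).
Proof.
move=> y; apply: funext => t; rewrite /dual_reflection cosine_matrix_diag; ring.
Qed.

(** Applied in turn, the two reflections subtract from [y] multiples of the two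
    rows of the cosine matrix; the successive multiples [z i] satisfy the
    recurrence of the cosine of [pi / k], and they sum to zero over a
    period. *)
Lemma dual_reflection_braid s t k y : m s t = Some k ->
  iter k (dual_reflection s \o dual_reflection t) y = y.
Proof.
move=> mst; have [m1 msym m2] := coxm.
have [st|st] := EM (s = t).
  move: mst; rewrite -st m1 => -[<-] /=; exact: dual_reflectionK.
have k1 : (1 < k)%N by apply: m2 mst.
pose f := dual_reflection s \o dual_reflection t.
pose q : R := 2 * cos (pi / k%:R).
have qst : cosine_matrix s t = - q by rewrite /cosine_matrix mst.
have qts : cosine_matrix t s = - q by rewrite cosine_matrix_sym.
(* The multiple subtracted by the [i]-th reflection. *)
pose z i :=
  if odd i then iter i./2 f y s + q * iter i./2 f y t else iter i./2 f y t.
have zSS i : z i.+2 = q * z i.+1 - z i.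
  rewrite /z /= negbK uphalf_half; case: (odd i) => /=.
    rewrite ?add1n /= /f /dual_reflection /= !cosine_matrix_diag qst qts; ring.
  rewrite ?add0n /f /dual_reflection /= !cosine_matrix_diag qst qts; ring.
have z_even j : z j.*2 = iter j f y t by rewrite /z odd_double doubleK.
have z_odd j : z j.*2.+1 = iter j f y s + q * iter j f y t.
  by rewrite /z /= odd_double uphalf_double.
have [S0 S1] := sum_recurrence_eq0 k1 zSS.
apply: funext => u.
have iterE i : iter i f y u = y u - cosine_matrix t u * (\sum_(j < i) z j.*2)
                                - cosine_matrix s u * (\sum_(j < i) z j.*2.+1).
  elim: i => [|i IH]; first by rewrite !big_ord0 /=; ring.
  rewrite iterS {1}/f /= {1}/dual_reflection {1}/dual_reflection IH
    !big_ord_recr /=.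
  rewrite z_even z_odd {1}/dual_reflection qts.
  ring.
by rewrite iterE S0 S1 !mulr0 !subr0.
Qed.

Lemma dual_relator w : coxeter_relator m w -> word_act dual_reflection w =1 id.
Proof.
by case=> s [t [k [mst ->]]] y; rewrite word_act_relator dual_reflection_braid.
Qed.

(** The functional that is [1] at [s] and [0] elsewhere is fixed by all
    generators other than [s] and negated at [s] by [s]. So [s] is not in the
    subgroup generated by the other letters, and the letters that occur in
    words for a finite generating set exhaust [S]. *)
Lemma finitely_generated_letters : finitely_generated G ->
  exists ss : seq {classic S}, forall s : {classic S}, s \in ss.
Proof.
move=> /finitely_generatedP[gs [_ gsG]].
pose w g : word S := sval (cid (presG.1 g)).
have wE g : eval_word iota (w g) = g by rewrite /w; case: cid.
pose letters (v : word S) : seq {classic S} := [seq l.1 | l <- v].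
exists (flatten [seq letters (w g) | g <- gs]) => s.
apply: contrapT => /negP sN.
pose act := group_act presG dual_reflection.
have actE v x : act (eval_word iota v) x = word_act dual_reflection v x.
  exact: (group_act_eval presG dual_reflectionK dual_relator).
pose d : S -> R := fun t => if (t : {classic S}) == s then 1 else 0.
have fix_d g : act g d = d.
  apply: (gsG (fun g => act g d = d)) => //.
    split=> [|x y xd yd|x xd].
    - exact: (group_act1 presG dual_reflectionK dual_relator).
    - rewrite /act (group_actM presG dual_reflectionK dual_relator).
      by rewrite -/(act y _) yd.
    rewrite -{1}xd /act -(group_actM presG dual_reflectionK dual_relator) mulVg.
    exact: (group_act1 presG dual_reflectionK dual_relator).
  move=> {}g ggs; rewrite -(wE g) actE.
  have : {subset letters (w g) <= flatten [seq letters (w g) | g <- gs]}.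
    by move=> t tw; apply/flatten_mapP; exists g.
  elim: (w g) => [//|[t b] v IH] sub; rewrite /= IH; last first.
    by move=> x xv; apply: sub; rewrite inE xv orbT.
  apply: funext => u; rewrite /dual_reflection {2}/d ifN ?mulr0 ?subr0 //.
  by apply: contraNneq sN => <-; apply: sub; rewrite mem_head.
have := congr1 (fun y => y s) (fix_d (eval_word iota [:: (s, false)])).
rewrite actE /= /dual_reflection cosine_matrix_diag /d eqxx; lra.
Qed.

(** Letting the group act on square matrices, column by column, gives [rho] as
    the image of the identity matrix; the sign comes from the action on
    booleans in which every generator is the negation. *)
Theorem coxeter_reflection_rep : finitely_generated G ->
  exists n (V : reflection_rep R G n), forall i j,
    cartan V i j = - 2 \/
    exists2 k, (0 < k)%N & cartan V i j = - (2 * cos (pi / k%:R)).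
Proof.
move=> /finitely_generated_letters[ss ssP]; have [m1 msym m2] := coxm.
pose us := undup ss; pose n := size us.
pose e (i : 'I_n) : S := tnth (in_tuple us) i.
have e_inj : injective e by apply/(@tuple_uniqP _ {classic S})/undup_uniq.
have usP (s : {classic S}) : s \in in_tuple us by rewrite mem_undup.
have /choice[d dK] (s : S) : exists i, e i = s.
  by have /tnthP[i ->] := usP s; exists i.
pose a i j := cosine_matrix (e i) (e j).
pose M i : 'M[R]_n := 1%:M - (\col_u a i u) *m delta_mx 0 i.
pose act s (A : 'M[R]_n) := M (d s) *m A.
have ME i (A : 'M[R]_n) l j : (M i *m A) l j = A l j - a i l * A i j.
  rewrite mulmxBl mul1mx -mulmxA -rowE mxE [X in _ + X]mxE
    [(_ *m row i A) _ _]mxE.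
  by rewrite big_ord1 [row _ _ _ _]mxE [(\col__ _) _ _]mxE.
pose col (A : 'M[R]_n) j : S -> R := fun s => A (d s) j.
have colP A B : (forall j, col A j = col B j) -> A = B.
  move=> AB; apply/matrixP=> i j; have := congr1 (fun y => y (e i)) (AB j).
  by rewrite /col (e_inj _ _ (dK (e i))).
have col_act s A j : col (act s A) j = dual_reflection s (col A j).
  by apply: funext => t; rewrite /col /act ME /a !dK.
have actK s : involutive (act s).
  by move=> A; apply: colP => j; rewrite !col_act dual_reflectionK.
have act_rel w : coxeter_relator m w -> word_act act w =1 id.
  case=> s [t [k [mst ->]]] A; apply: colP => j; rewrite word_act_relator.
  rewrite -[RHS](dual_reflection_braid _ mst).
  by elim: k {mst} => [//|k IH]; rewrite !iterS -IH /= !col_act.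
pose ga := group_act presG act; pose rho g := ga g 1%:M.
have gaE g A : ga g A = rho g *m A.
  rewrite /rho; apply: (@group_act_ind _ _ _ _ presG _ act
    (fun f => f A = f 1%:M *m A) _ _ g) => [|s f IH]; first by rewrite mul1mx.
  by rewrite /= IH /act mulmxA.
have neg_rel w : coxeter_relator m w -> word_act (fun _ : S => negb) w =1 id.
  case=> s [t [k [_ ->]]] b; rewrite word_act_relator.
  by elim: k => [//|k IH]; rewrite iterS IH /= negbK.
pose gs := group_act presG (fun _ : S => negb); pose sg g := gs g false.
have gsE g b : gs g b = sg g (+) b.
  rewrite /sg; apply: (@group_act_ind _ _ _ _ presG _ (fun=> negb)
    (fun f => f b = f false (+) b) _ _ g) => [|s f IH] //=.
  by rewrite IH addNb.
have pres1 w : word_eq (coxeter_relator m) w [::] -> eval_word iota w = 1%g.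
  by move=> w1; apply/presG.2.
have braid s t k : m s t = Some k -> ((iota s * iota t) ^+ k)%g = 1%g.
  move=> mst; rewrite -eval_word_relator; apply/pres1/word_eq_relator.
  by exists s, t, k.
have iotaK s : (iota s * iota s)%g = 1%g by have := braid s s 1%N (m1 s).
unshelve eexists n,
  (@ReflectionRep R G n (iota \o e) a rho sg _ _ _ _ _ _ _ _ _ _).
- move=> P [P1 PM PV] Pe x; have [w <-] := presG.1 x.
  elim: w => [|[s b] w IH]; first by rewrite /eval_word big_nil.
  have Ps : P (iota s) by rewrite -(dK s); apply: Pe.
  by rewrite eval_word_cons; apply: PM => //=; case: b => //; apply: PV.
- by move=> i; apply: iotaK.
- exact: (group_act1 presG actK act_rel).
- by move=> x y; rewrite -gaE /rho /ga (group_actM presG actK act_rel).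
- move=> i; rewrite /rho /ga /= (group_act_gen presG actK act_rel) /act.
  by rewrite mulmx1 (e_inj _ _ (dK (e i))).
- by move=> x y; rewrite -gsE /sg /gs (group_actM presG (fun=> negbK) neg_rel).
- by move=> i; rewrite /sg /gs /= (group_act_gen presG (fun=> negbK) neg_rel).
- by move=> i; apply: cosine_matrix_diag.
- by move=> i j; apply: cosine_matrix_sym.
- move=> i j ij; have eij : e i <> e j.
    by move=> /e_inj eij; rewrite eij eqxx in ij.
  rewrite /a /cosine_matrix; case mij : (m (e i) (e j)) => [k|].
    have k1 := m2 _ _ _ eij mij; left; exists k; first exact: ltnW.
    by split=> [|l lk]; [apply: braid | rewrite opprK; apply: cheb_ge0].
  by right=> k; rewrite opprK; apply: cheb2_ge0.
move=> i j /=; rewrite /a /cosine_matrix; case mij : (m (e i) (e j)) => [k|];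
  last by left.
right; exists k => //; have [eij|eij] := EM (e i = e j).
  by move: mij; rewrite eij m1 => -[<-].
exact: ltnW (m2 _ _ _ eij mij).
Qed.

End GeometricRepresentation.

(** * Integrality and congruence subgroups *)

Section IntegerSpan.
Variable R : realFieldType.

Definition zspan D (e : 'I_D -> R) (x : R) : Prop :=
  exists z : 'I_D -> int, x = \sum_i (z i)%:~R * e i.

(** A finitely generated torsion-free abelian group contains no nonzero element
    divisible by all powers of [p]. If the generators are independent, the
    coordinates of [x] are divisible by all powers of [p]; otherwise a relation
    with nonzero coefficient [c i] puts [c i * x] in the span of the others. *)
Lemma pdivisible_eq0 (p : nat) : (1 < p)%N -> forall D (e : 'I_D -> R) x,
  (forall k, exists2 y, zspan e y & x = p%:R ^+ k * y) -> x = 0.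
Proof.
move=> p1; elim=> [|D IH] e x xdiv.
  by have [y [z ->]] := xdiv 0%N; rewrite big_ord0 mulr0.
have [[c [i ci] ce]|free] := EM (exists2 c : 'I_D.+1 -> int,
    exists i, c i != 0 & \sum_i (c i)%:~R * e i = 0); last first.
  have [y0 [z0 y0E] xE] := xdiv 0%N; rewrite expr0 mul1r in xE.
  rewrite xE y0E big1 // => i _; suff -> : z0 i = 0 by rewrite mul0r.
  apply: contrapT => /eqP zi; have [y [z yE] xyE] := xdiv `|z0 i|%N.
  case: free; exists (fun j => z0 j - (p ^ `|z0 i|)%:Z * z j); last first.
    rewrite -[RHS](subrr x) {1}xE xyE y0E yE mulr_sumr -sumrB.
    apply: eq_bigr => j _; rewrite rmorphB rmorphM /= mulrBl mulrA.
    by congr (_ - _ * _ * _); rewrite -pmulrn natrX.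
  exists i; apply/eqP => /eqP; rewrite subr_eq0 => /eqP zE.
  have : (p ^ `|z0 i| <= `|z0 i|)%N.
    apply: dvdn_leq; first by rewrite absz_gt0.
    by rewrite {2}zE abszM dvdn_mulr.
  by rewrite leqNgt ltn_expl.
suff : (c i)%:~R * x = 0.
  by move/eqP; rewrite mulf_eq0 intr_eq0 (negbTE ci) => /eqP.
apply: (IH (e \o lift i)) => k; have [y [z yE] ->] := xdiv k.
exists ((c i)%:~R * y); last by rewrite mulrCA.
exists (fun j => c i * z (lift i j) - z i * c (lift i j)).
rewrite (bigD1_ord i) //= in ce; rewrite yE (bigD1_ord i) //=.
have cei : (c i)%:~R * e i = - \sum_(j < D) (c (lift i j))%:~R * e (lift i j).
  by apply/eqP; rewrite -addr_eq0 ce.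
rewrite mulrDr mulrCA cei mulrN !mulr_sumr addrC -sumrB.
by apply: eq_bigr => j _; rewrite rmorphB !rmorphM /=; ring.
Qed.

Section Span.
Variables (D : nat) (e : 'I_D -> R).

Lemma zspan0 : zspan e 0.
Proof. by exists (fun=> 0); rewrite big1 // => i _; rewrite mul0r. Qed.

Lemma zspanD x y : zspan e x -> zspan e y -> zspan e (x + y).
Proof.
move=> [z ->] [t ->]; exists (fun i => z i + t i); rewrite -big_split.
by apply: eq_bigr => i _; rewrite rmorphD mulrDl.
Qed.

Lemma zspanZ (c : int) x : zspan e x -> zspan e (c%:~R * x).
Proof.
move=> [z ->]; exists (fun i => c * z i); rewrite mulr_sumr.
by apply: eq_bigr => i _; rewrite rmorphM mulrA.
Qed.

Lemma zspanN x : zspan e x -> zspan e (- x).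
Proof. by move/(zspanZ (-1)); rewrite mulN1r. Qed.

Lemma zspan_gen i : zspan e (e i).
Proof.
exists (fun j => (j == i)%:Z); rewrite (bigD1 i) //= eqxx mul1r big1 ?addr0 //.
by move=> j /negbTE->; rewrite mul0r.
Qed.

Lemma zspan_sum (I : Type) (s : seq I) (f : I -> R) :
  (forall i, zspan e (f i)) -> zspan e (\sum_(i <- s) f i).
Proof.
by move=> fP; apply: big_ind => //; [exact: zspan0 | exact: zspanD].
Qed.

Lemma zspanM : (forall i j, zspan e (e i * e j)) ->
  forall x y, zspan e x -> zspan e y -> zspan e (x * y).
Proof.
move=> eM x y [z ->] [t ->]; rewrite mulr_suml; apply: zspan_sum => i.
rewrite mulr_sumr; apply: zspan_sum => j.
by rewrite mulrACA -rmorphM; apply: zspanZ.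
Qed.

End Span.
End IntegerSpan.

Section Cosines.
Variables (R : realType) (N : nat).
Hypothesis N_gt0 : (0 < N)%N.
Let x : R := pi / N%:R.

(** The integral combinations of these numbers form a ring, by the formula that
    turns a product of two cosines into a sum; [1] is added because the double
    cosines alone need not span it. *)
Definition cosines (i : 'I_N.+1) : R :=
  if (i < N)%N then 2 * cos (x *+ i) else 1.

Lemma zspan_cosines1 : zspan cosines 1.
Proof. by have := zspan_gen cosines ord_max; rewrite {2}/cosines ltnn. Qed.

(** Reduction modulo [N], by [cos (t + pi) = - cos t]. *)
Lemma zspan_cos k : zspan cosines (2 * cos (x *+ k)).
Proof.
have [l] := ubnP k; elim: l k => // l IH k; rewrite ltnS => kl.
have [kN|Nk] := ltnP k N.
  have := zspan_gen cosines (inord k); rewrite {2}/cosines inordK ?kN //.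
  exact: ltnW.
have -> : x *+ k = x *+ (k - N) + pi.
  rewrite -{1}(subnK Nk) mulrnDr -[x *+ N]mulr_natr divfK //.
  by rewrite pnatr_eq0 -lt0n.
rewrite cosDpi mulrN; apply/zspanN/IH/(leq_trans _ kl).
by rewrite ltn_subrL N_gt0 (leq_trans N_gt0).
Qed.

Lemma zspan_cosinesM y z : zspan cosines y -> zspan cosines z ->
  zspan cosines (y * z).
Proof.
apply: zspanM => {y z} i j; rewrite /cosines.
case: ifP => _; case: ifP => _; rewrite ?mulr1 ?mul1r; try exact: zspan_cos.
  have -> : 2 * cos (x *+ i) * (2 * cos (x *+ j)) =
      2 * cos (x *+ (i + j)) + 2 * cos (x *+ (maxn i j - minn i j)).
    have -> : cos (x *+ (maxn i j - minn i j)) = cos (x *+ i - x *+ j).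
      case: (leqP i j) => ij; last by rewrite mulrnBr // ltnW.
      by rewrite mulrnBr // -cosN opprB.
    by rewrite mulrnDr cosD cosB; ring.
  by apply: zspanD; apply: zspan_cos.
exact: zspan_cosines1.
Qed.

Lemma zspan_cos_div k : (0 < k)%N -> (k %| N)%N ->
  zspan cosines (2 * cos (pi / k%:R)).
Proof.
move=> k_gt0 kN; have := zspan_cos (N %/ k); congr (zspan _ (_ * cos _)).
have k0 : k%:R != 0 :> R by rewrite pnatr_eq0 -lt0n.
have N0 : N%:R != 0 :> R by rewrite pnatr_eq0 -lt0n.
apply: (mulIf k0); rewrite divfK // -mulrnAr -mulr_natr.
by rewrite -mulrA -mulrA -natrM divnK // mulVf ?mulr1.
Qed.

End Cosines.

Section CongruenceFiltration.
Variables (R : realFieldType) (G : groupType) (n : nat).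
Variable V : reflection_rep R G n.
Variables (D : nat) (e : 'I_D -> R).
Hypothesis e1 : zspan e 1.
Hypothesis eM : forall x y, zspan e x -> zspan e y -> zspan e (x * y).
Hypothesis e_cartan : forall i j, zspan e (cartan V i j).
Variable p : nat.
Hypothesis p_gt1 : (1 < p)%N.
Local Notation rho := (rho V).
Implicit Types (A B : 'M[R]_n) (g h : G).

(** The matrices with entries in [p^k] times the ring spanned by [e]. *)
Definition pdiv_mx k A : Prop :=
  forall i j, exists2 y, zspan e y & A i j = p%:R ^+ k * y.

Lemma pdiv_mxD k A B : pdiv_mx k A -> pdiv_mx k B -> pdiv_mx k (A + B).
Proof.
move=> Ak Bk i j; have [[y ey yE] [z ez zE]] := (Ak i j, Bk i j).
by exists (y + z); rewrite ?mxE ?yE ?zE ?mulrDr //; apply: zspanD.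
Qed.

Lemma pdiv_mxN k A : pdiv_mx k A -> pdiv_mx k (- A).
Proof.
move=> Ak i j; have [y ey yE] := Ak i j.
by exists (- y); rewrite ?mxE ?yE ?mulrN //; apply: zspanN.
Qed.

Lemma zspan_nat l : zspan e l%:R.
Proof. by have := zspanZ l e1; rewrite mulr1 -pmulrn. Qed.

Lemma pdiv_mxW k l A : (k <= l)%N -> pdiv_mx l A -> pdiv_mx k A.
Proof.
move=> kl Al i j; have [y ey yE] := Al i j; exists (p%:R ^+ (l - k) * y).
  by apply: eM => //; rewrite -natrX; apply: zspan_nat.
by rewrite mulrA -exprD subnKC.
Qed.

Lemma pdiv_mxM k l A B : pdiv_mx k A -> pdiv_mx l B -> pdiv_mx (k + l) (A *m B).
Proof.
move=> Ak Bl i j; rewrite mxE.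
have /choice[f fP] t :
    exists y, zspan e y /\ A i t * B t j = p%:R ^+ (k + l) * y.
  have [[y ey ->] [z ez ->]] := (Ak i t, Bl t j); exists (y * z).
  by split; [exact: eM | rewrite exprD mulrACA].
exists (\sum_t f t); first by apply: zspan_sum => t; case: (fP t).
by rewrite mulr_sumr; apply: eq_bigr => t _; case: (fP t).
Qed.

Lemma pdiv_mxZ k A : pdiv_mx k A -> pdiv_mx k.+1 (p%:R *: A).
Proof.
move=> Ak i j; have [y ey yE] := Ak i j.
by exists y; rewrite ?mxE ?yE // exprS mulrA.
Qed.

Lemma pdiv_mx0 k : pdiv_mx k 0.
Proof. by move=> i j; exists 0; rewrite ?mxE ?mulr0 //; apply: zspan0. Qed.

Lemma pdiv_mx_nat k l A : pdiv_mx k A -> pdiv_mx k (l%:R *: A).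
Proof.
move=> Ak i j; have [y ey yE] := Ak i j; exists (l%:R * y).
  exact/eM/ey/zspan_nat.
by rewrite mxE yE mulrCA.
Qed.

Lemma pdiv_mx_rho g : pdiv_mx 0 (rho g).
Proof.
have entry A : (forall i j, zspan e (A i j)) -> pdiv_mx 0 A.
  by move=> eA i j; exists (A i j); rewrite ?expr0 ?mul1r.
have nat_entry (b : bool) : zspan e b%:R by apply: zspan_nat.
suff [] : pdiv_mx 0 (rho g) /\ pdiv_mx 0 (rho g^-1%g) by [].
move: g; apply: (gen_generates (r := V)) => [|i].
  split; first by rewrite invg1 rho1; split; apply: entry => i j; rewrite mxE.
    move=> x y [rx rxV] [ry ryV]; rewrite invgM !rhoM.
    by split; apply: (@pdiv_mxM 0 0).
  by move=> x [? ?]; rewrite invgK.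
rewrite genV; split; rewrite rho_gen; apply: entry => u v.
all: rewrite !mxE big_ord1 !mxE; apply: zspanD => //; apply/zspanN/eM => //.
Qed.

(** The kernel of reduction modulo [p^(k+1)]: with this shift the filtration
    starts at index [0]. *)
Definition congruence k g : Prop := pdiv_mx k.+1 (rho g - 1%:M).

Lemma congruence_subgroup k : is_subgroup (congruence k).
Proof.
split=> [|x y xk yk|x xk]; rewrite /congruence.
- by rewrite rho1 subrr; apply: pdiv_mx0.
- rewrite rhoM (_ : _ - _ = (rho x - 1%:M) *m rho y + (rho y - 1%:M)).
    by apply: pdiv_mxD => //; rewrite -[k.+1]addn0; apply/pdiv_mxM/pdiv_mx_rho.
  by rewrite mulmxBl mul1mx addrA subrK.
rewrite (_ : _ - _ = - (rho x^-1%g *m (rho x - 1%:M))).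
  by apply/pdiv_mxN/(@pdiv_mxM 0 k.+1) => //; apply: pdiv_mx_rho.
by rewrite mulmxBr mulmx1 rhoVK opprB.
Qed.

Lemma congruence_normal k : is_normal (congruence k).
Proof.
move=> x y xk; rewrite /congruence conjgE !rhoM.
rewrite (_ : _ - _ = rho y^-1%g *m ((rho x - 1%:M) *m rho y)).
  apply: (@pdiv_mxM 0 k.+1); first exact: pdiv_mx_rho.
  by rewrite -[k.+1]addn0; apply/pdiv_mxM/pdiv_mx_rho.
by rewrite mulmxBl mul1mx mulmxBr rhoVK.
Qed.

(** Up to an invertible factor, [rho] of the commutator minus [1] is
    [rho x *m rho y - rho y *m rho x], the commutator of the matrices
    [rho x - 1] and [rho y - 1]. *)
Lemma congruence_comm i j x y :
  congruence i x -> congruence j y -> congruence (i + j).+1 [~ x, y]%g.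
Proof.
move=> xi yj; rewrite /congruence.
rewrite (_ : _ - _ = rho (x^-1 * y^-1)%g *m
  ((rho x - 1%:M) *m (rho y - 1%:M) - (rho y - 1%:M) *m (rho x - 1%:M))).
  apply: (@pdiv_mxM 0 (i + j).+2); first exact: pdiv_mx_rho.
  rewrite -addSn -addnS; apply: pdiv_mxD; first exact: pdiv_mxM.
  by apply: pdiv_mxN; rewrite addnC; apply: pdiv_mxM.
have -> : (rho x - 1%:M) *m (rho y - 1%:M) - (rho y - 1%:M) *m (rho x - 1%:M) =
    rho x *m rho y - rho y *m rho x.
  rewrite !mulmxBl !mulmxBr !mulmx1 !mul1mx; apply/matrixP=> u v;
    rewrite !mxE; ring.
rewrite mulmxBr -!rhoM commgEl conjgE.
have -> : (x^-1 * y^-1 * (y * x) = 1)%g by rewrite -mulgA mulKg mulVg.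
by rewrite rho1 -mulgA.
Qed.

(** With [A = rho x - 1], the power [x^l] is [1 + l A] up to terms divisible by
    [A^2], and [p A] gains a factor [p]. *)
Lemma congruenceX i x : congruence i x -> congruence i.+1 (x ^+ p)%g.
Proof.
rewrite {1}/congruence; set A := rho x - 1%:M => Ai.
have XE : rho x = 1%:M + A by rewrite addrC subrK.
clearbody A.
have X l : pdiv_mx i.+2 (rho (x ^+ l)%g - 1%:M - l%:R *: A).
  elim: l => [|l IH]; first by rewrite expg0 rho1 subrr scale0r subrr;
    apply: pdiv_mx0.
  rewrite (_ : _ - _ = (rho (x ^+ l)%g - 1%:M - l%:R *: A) *m rho x +
                       l%:R *: (A *m A)).
    apply: pdiv_mxD; first by rewrite -[i.+2]addn0; apply/pdiv_mxM/pdiv_mx_rho.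
    apply/pdiv_mx_nat/(@pdiv_mxW _ (i.+1 + i.+1)); last exact: pdiv_mxM.
    by rewrite addSn addnS !ltnS leq_addr.
  have AX : A *m rho x = A + A *m A by rewrite XE mulmxDr mulmx1.
  rewrite expgSr rhoM !mulmxBl mul1mx -scalemxAl AX -natr1.
  move: (rho (x ^+ l)%g *m rho x) => B; rewrite XE; move: (A *m A) (A) => C E.
  by apply/matrixP=> u v; rewrite !mxE; ring.
rewrite /congruence -[rho _ - _](subrK (p%:R *: A)).
by apply: pdiv_mxD (X p) _; apply: pdiv_mxZ.
Qed.

Lemma congruence_filtration : p_filtration p congruence.
Proof.
split; [exact: congruence_subgroup | | exact: congruence_comm |];
  last exact: congruenceX.
by move=> k x; apply: pdiv_mxW.
Qed.

Lemma congruence_cap x : (forall k, congruence k x) -> x = 1%g.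
Proof.
move=> xk; have rx : rho x = 1%:M.
  apply/eqP; rewrite -subr_eq0; apply/eqP/matrixP=> i j; rewrite [RHS]mxE.
  apply: (pdivisible_eq0 p_gt1 (e := e)) => k.
  exact: (pdiv_mxW (leqnSn k) (xk k)).
apply: (nonneg_root1 (V := V)) => s j.
by rewrite /wroot -[rho _]mul1mx -rx -rhoM mulgV rho1 !mxE ler0n.
Qed.

(** The entries have integral coordinates on the finite family [e]; the
    residues of these coordinates modulo [p^(k+1)] determine the coset. *)
Lemma fin_index_congruence k : fin_index (congruence k).
Proof.
have /choice[z zE] (gij : G * 'I_n * 'I_n) : exists z : 'I_D -> int,
    rho gij.1.1 gij.1.2 gij.2 = \sum_l (z l)%:~R * e l.
  case: gij => [[g i] j] /=; have [y [z ->] ->] := pdiv_mx_rho g i j.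
  by exists z; rewrite expr0 mul1r.
pose q := (p ^ k.+1)%N; have q_gt0 : (0 < q)%N by rewrite expn_gt0 ltnW.
pose f g : {ffun 'I_n * 'I_n * 'I_D -> 'I_q.+1} :=
  [ffun ijl => inord `|(z (g, ijl.1.1, ijl.1.2) ijl.2 %% q)%Z|%N].
exists {ffun 'I_n * 'I_n * 'I_D -> 'I_q.+1}, f => x y /ffunP xy.
have resE i j l : (z (x, i, j) l = z (y, i, j) l %[mod q])%Z.
  have := xy (i, j, l); rewrite !ffunE /= => /(congr1 val).
  have q0 : q%:Z != 0 by rewrite -lt0n.
  have le t : (`|(t %% q)%Z|%N < q.+1)%N.
    by rewrite ltnS -lez_nat gez0_abs ?modz_ge0 // ltW // ltz_pmod.
  rewrite /= !inordK // => /(congr1 Posz).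
  by rewrite !gez0_abs ?modz_ge0.
rewrite /congruence rhoM (_ : _ - _ = rho x^-1%g *m (rho y - rho x));
  last first.
  by rewrite mulmxBr rhoVK.
apply: (@pdiv_mxM 0 k.+1); first exact: pdiv_mx_rho.
move=> i j.
exists (\sum_l ((z (y, i, j) l %/ q)%Z - (z (x, i, j) l %/ q)%Z)%:~R * e l).
  by eexists.
rewrite [LHS]mxE [(- rho x) _ _]mxE (zE (x, i, j)) (zE (y, i, j)) /=.
rewrite -sumrB mulr_sumr; apply: eq_bigr => l _.
rewrite {1}(divz_eq (z (y, i, j) l) q) {1}(divz_eq (z (x, i, j) l) q) resE.
by rewrite !rmorphD !rmorphM rmorphN /= -natrX -/q; ring.
Qed.

End CongruenceFiltration.

(** All angles [pi / k] are multiples of [pi / N], where [N] is a common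
    multiple of the orders of the finite bonds. *)
Theorem reflection_rep_p_filtrations (R : realType) (G : groupType) (n : nat)
    (V : reflection_rep R G n) :
  (forall i j, cartan V i j = - 2 \/
     exists2 k, (0 < k)%N & cartan V i j = - (2 * cos (pi / k%:R))) ->
  has_p_filtrations G.
Proof.
move=> cartanV p p_prime.
have /choice[k kP] (ij : 'I_n * 'I_n) : exists k, (0 < k)%N /\
    (cartan V ij.1 ij.2 = - 2 \/ cartan V ij.1 ij.2 = - (2 * cos (pi / k%:R))).
  by have [E|[k k0 E]] := cartanV ij.1 ij.2; [exists 1%N | exists k];
    split; auto.
pose N := (\prod_ij k ij)%N.
have N_gt0 : (0 < N)%N by apply: prodn_gt0 => ij; case: (kP ij).
pose e := @cosines R N.
have e1 : zspan e 1 := zspan_cosines1 R N.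
have eM x y : zspan e x -> zspan e y -> zspan e (x * y).
  exact: zspan_cosinesM.
have eV i j : zspan e (cartan V i j).
  have [k0] := kP (i, j); case=> /= ->; apply: zspanN.
    by have := zspan_cos R N_gt0 0; rewrite mulr0n cos0 mulr1.
  apply: zspan_cos_div => //.
  by rewrite /N (bigD1 (i, j)) //= dvdn_mulr.
have p_gt1 := prime_gt1 p_prime.
exists (congruence V e p); split.
- exact: congruence_filtration.
- exact: congruence_normal.
- exact: fin_index_congruence.
- exact: congruence_cap.
Qed.

Local Close Scope ring_scope.

(** * Outer automorphisms of Coxeter groups *)

Theorem theorem3 (G : groupType) (coxG : is_coxeter_group G)
    (fgG : finitely_generated G) :
  [/\ splits_virtually (out_proj G),
      (exists exceptions : seq nat, forall p : nat,
         prime p -> p \notin exceptions -> virtually (residually_p p) (Out G)),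
      residually_finite (Out G)
    & virtually torsion_free (Out G)].
Proof.
have [S [m [iota [coxm presG]]]] := coxG.
have [n [V cartanV]] := coxeter_reflection_rep Rdefinitions.R coxm presG fgG.
have [F [E [C rigF]]] := coxeter_rigid_family V.
have [splitG resG rfG tfG] :=
  virtual_splitting_criterion fgG (reflection_rep_p_filtrations cartanV) rigF.
by split=> //; exists [::] => p p_prime _; apply: resG.
Qed.
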